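(* Let $K\ge1$ be fixed, $\boldsymbol{\beta}_0\in\mathbb{R}^K$, and for each $n>K$ let the $n\times K$ design matrix $\mathbf{X}$ with rows $\mathbf{x}_i$ satisfy $\mathbf{X}^t\mathbf{X}=n\mathbf{I}$, $\sum_{i=1}^n x_{i,k}=0$ for each $k$, and $\max_{1\le i\le n}\|\mathbf{x}_i\|/\sqrt n\to0$. Suppose $Y_i=\mathbf{x}_i^t\boldsymbol{\beta}_0+\varepsilon_i$ with $\varepsilon_i$ independent, $\mathbb{E}(\varepsilon_i)=0$, $\mathbb{E}(\varepsilon_i^2)=\sigma_0^2>0$, $\mathbb{E}(\varepsilon_i^4)\le M<\infty$. Consider the rescaled spike and slab model with $\lambda_n=n$, and priors $\pi,\mu$ such that $\pi\{\gamma_k\ge\eta_0\}=1$ for some $\eta_0>0$ and every $k$, and $\mu\{\sigma^2\le s_0^2\}=1$ for some $0<s_0^2<\infty$. Let $C_n\to\infty$ be any positive increasing sequence with $C_n/\sqrt n\to0$ and let $\widehat{\mathcal{M}}_n=\mathcal{M}_n(C_n)$. Then $\widehat{\mathcal{M}}_n\to\mathcal{M}_0$ in probability.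
   Context: $\mathbf{Y}=(Y_1,\dots,Y_n)^t$, OLS $\widehat{\boldsymbol{\beta}}_n^\circ=(\mathbf{X}^t\mathbf{X})^{-1}\mathbf{X}^t\mathbf{Y}$, $\widehat\sigma_n^2=\|\mathbf{Y}-\mathbf{X}\widehat{\boldsymbol{\beta}}_n^\circ\|^2/(n-K)$. Rescaled spike and slab model: $Y_i^*=\widehat\sigma_n^{-1}n^{1/2}Y_i$, and as data $\mathbf{Y}^*$ is modeled by $(Y_i^*\mid\boldsymbol{\beta},\sigma^2)$ independent $N(\mathbf{x}_i^t\boldsymbol{\beta},\sigma^2\lambda_n)$, $(\boldsymbol{\beta}\mid\boldsymbol{\gamma})\sim N(\mathbf{0},\mathrm{diag}(\gamma_1,\dots,\gamma_K))$, $\boldsymbol{\gamma}\sim\pi$, $\sigma^2\sim\mu$, with $\pi\{\gamma_k>0\}=1$, $\mu\{\sigma^2>0\}=1$. $\widehat{\boldsymbol{\beta}}_n^*=(\widehat\beta_{1,n}^*,\dots,\widehat\beta_{K,n}^* )^t$ is the posterior mean of $\boldsymbol{\beta}$ given $\mathbf{Y}^*$. $\mathcal{M}_0=(\mathbb{I}\{\beta_{1,0}\ne0\},\dots,\mathbb{I}\{\beta_{K,0}\ne0\})^t$ and, for $C>0$, $\mathcal{M}_n(C)=(\mathbb{I}\{|\widehat\beta_{1,n}^*|\ge C\},\dots,\mathbb{I}\{|\widehat\beta_{K,n}^*|\ge C\})^t$. *)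

(* Defs.v *)
From HB Require Import structures.
From mathcomp Require Import all_boot all_order all_algebra.
From mathcomp Require Import all_classical all_reals all_analysis.
Set Implicit Arguments. Unset Strict Implicit. Unset Printing Implicit Defensive.
Import Order.TTheory GRing.Theory Num.Theory.
Import numFieldNormedType.Exports.
Local Open Scope classical_set_scope.
Local Open Scope ring_scope.

Section SpikeSlab.
Context {R : realType}.

Definition mutually_independent {d} {T : measurableType d}
  (P : probability T R) (X : nat -> T -> R) : Prop :=
  forall (s : seq nat) (B : nat -> set R), uniq s ->
    (forall i, measurable (B i)) ->
    P (\bigcap_(i in [set j | j \in s]) (X i @^-1` B i))
    = \big[*%E/1%E]_(i <- s) P (X i @^-1` B i).

Definition upd (K : nat) (b : 'I_K -> R) (j : nat) (x : R) : 'I_K -> R :=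
  fun i => if val i == j then x else b i.

(* Iterated Lebesgue integral over the coordinates 0..k-1 of a function on
   R^K (the remaining coordinates being read from v).  [iint K f (fun=>0)] is
   the Lebesgue integral of f over R^K (Fubini/Tonelli). *)
Fixpoint iint (K : nat) (k : nat) (f : ('I_K -> R) -> \bar R)
  (v : 'I_K -> R) : \bar R :=
  match k with
  | 0 => f v
  | k'.+1 => (\int[lebesgue_measure]_x iint k' f (upd v k' x))%E
  end.

Definition intRK (K : nat) (f : ('I_K -> R) -> \bar R) : \bar R :=
  iint K f (fun=> 0).

Definition gauss (m v x : R) : R := normal_pdf m (Num.sqrt v) x.

Definition lik (n K : nat) (X : 'M[R]_(n, K)) (lam : R) (y : 'cV[R]_n)
  (b : 'I_K -> R) (s2 : R) : R :=
  \prod_(i < n) gauss (\sum_(k < K) X i k * b k) (s2 * lam) (y i ord0).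

Definition prior_beta (K : nat) (b g : 'I_K -> R) : R :=
  \prod_(k < K) gauss 0 (g k) (b k).

(* Posterior mean of beta_k given Y* = y in the hierarchical model
   (Y*|beta,sigma^2) ~ N(X beta, sigma^2 lam I), (beta|gamma) ~ N(0,diag gamma),
   gamma ~ pi (realized as the law of gam under piG), sigma^2 ~ mu,
   gamma and sigma^2 independent a priori (Bayes formula). *)
Definition post_mean {dG} {TG : measurableType dG} (n K : nat)
  (X : 'M[R]_(n, K)) (lam : R) (piG : probability TG R) (gam : TG -> 'I_K -> R)
  (mu : probability R R) (y : 'cV[R]_n) (k : 'I_K) : R :=
  let num := (\int[piG]_t \int[mu]_s2
                intRK (fun b => (b k * lik X lam y b s2 * prior_beta b (gam t))%:E))%E in
  let den := (\int[piG]_t \int[mu]_s2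
                intRK (fun b => (lik X lam y b s2 * prior_beta b (gam t))%:E))%E in
  fine num / fine den.

Definition resp (n K : nat) (X : 'M[R]_(n, K)) (beta0 : 'cV[R]_K) (e : nat -> R)
  : 'cV[R]_n := X *m beta0 + \col_(i < n) e (val i).

Definition ols (n K : nat) (X : 'M[R]_(n, K)) (Y : 'cV[R]_n) : 'cV[R]_K :=
  invmx (X^T *m X) *m X^T *m Y.

Definition sigma2hat (n K : nat) (X : 'M[R]_(n, K)) (Y : 'cV[R]_n) : R :=
  (\sum_(i < n) ((Y - X *m ols X Y) i ord0) ^+ 2) / (n - K)%:R.

Definition rescaled (n K : nat) (X : 'M[R]_(n, K)) (Y : 'cV[R]_n) : 'cV[R]_n :=
  ((Num.sqrt (sigma2hat X Y))^-1 * Num.sqrt n%:R) *: Y.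

Definition beta_star {dG} {TG : measurableType dG} (n K : nat)
  (X : 'M[R]_(n, K)) (piG : probability TG R) (gam : TG -> 'I_K -> R)
  (mu : probability R R) (Y : 'cV[R]_n) (k : 'I_K) : R :=
  post_mean X n%:R piG gam mu (rescaled X Y) k.

Definition M0 (K : nat) (beta0 : 'cV[R]_K) : 'I_K -> bool :=
  fun k => beta0 k ord0 != 0.

Definition Mn (K : nat) (bstar : 'I_K -> R) (C : R) : 'I_K -> bool :=
  fun k => C <= `|bstar k|.

End SpikeSlab.

(* Main.v *)
Require Import Defs.
From HB Require Import structures.
From mathcomp Require Import all_boot all_order all_algebra.
From mathcomp Require Import all_classical all_reals all_analysis.
From mathcomp Require Import measurable_realfun.
From mathcomp Require Import ring lra.
Import Order.TTheory GRing.Theory Num.Theory.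
Import numFieldNormedType.Exports.
Local Open Scope classical_set_scope.
Local Open Scope ring_scope.

(** Since X^t X = n I, the likelihood times the prior factors over the
    coordinates of beta, and completing the square shows that, given
    (gamma, sigma^2), the posterior mean of beta_k is
    z_k gamma_k / (gamma_k + sigma^2) with z = X^t Y* / n. Averaging over the
    posterior of (gamma, sigma^2) therefore gives beta*_k = rho_k z_k with
    eta0 / (eta0 + s0^2) <= rho_k <= 1, and z_k = sqrt n (OLS)_k / sigma-hat.
    Chebyshev's inequality for sums of uncorrelated variables controls both
    sum_i (eps_i^2 - sigma0^2), hence sigma-hat, and the scores
    sum_i x_ik eps_i, which are below sqrt n times sigma0 C_n / 2 with
    probability tending to 1. On that event |z_k| < C_n when beta_k,0 = 0,
    while |beta*_k| is of order sqrt n, hence at least C_n, otherwise. *)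

(** * Measure-theoretic preliminaries and the mean of a normal density *)

(** The prior may put mass arbitrarily close to sigma^2 = 0, where the likelihood carries the factor
    (sigma^2)^(-n/2). The Bayes ratio is under control once the evidence is integrable, and a
    positive residual sum of squares a of Y* secures this: it contributes exp(- a / (2 n sigma^2)),
    which beats that power. There remain the samples with zero residual. For them sigma-hat = 0, the
    convention that the inverse of 0 is 0 sends Y* to 0, and the factored form of beta*_k still
    holds as 0 = 0. Having it for every sample makes the event of a wrong selection measurable, so
    that monotonicity of P bounds it by the bad noise events. The Gaussian likelihood is only a
    working model: the errors enter through second moments of sums of eps_i and of eps_i^2 -
    sigma0^2, and independence enters through the vanishing of their cross moments. *)

Lemma measurable_invr (R : realType) : measurable_fun [set: R] (@GRing.inv R).
Proof.
(* A real power with nonnegative base is known to be measurable; both sides are 0 at x = 0. *)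
rewrite (_ : @GRing.inv R = fun x => x * (x ^+ 2) `^ (-1)); last first.
  apply/funext => x; rewrite powR_inv1 ?sqr_ge0//.
  have [->|x0] := eqVneq x 0; first by rewrite invr0 mul0r.
  by rewrite expr2 invfM mulrA mulfV// mul1r.
apply: measurable_funM => //.
apply: (@measurableT_comp _ _ _ _ _ _ (fun y : R => y `^ (-1))).
  exact: measurable_powR.
exact: exprn_measurable.
Qed.

Lemma measurable_sqrtr (R : realType) : measurable_fun [set: R] (@Num.sqrt R).
Proof.
apply: nondecreasing_measurable => // x y xy.
exact: ler_wsqrtr.
Qed.

Section null_integral.
Import HBNNSimple.

(* Neither [f] nor [g] has to be measurable: every simple function below [f]
   is, off the null set, a simple function below [g]. *)
Lemma eq_integral_null {d} {T : measurableType d} {R : realType}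
    (mu : {measure set T -> \bar R}) (N : set T) (f g : T -> \bar R) :
  measurable N -> mu N = 0%E -> (forall x, ~ N x -> f x = g x) ->
  (\int[mu]_x f x = \int[mu]_x g x)%E.
Proof.
move=> mN N0.
have ge0_le (u v : T -> \bar R) : (forall x, 0 <= u x)%E ->
    (forall x, 0 <= v x)%E -> (forall x, ~ N x -> u x = v x) ->
    (\int[mu]_x u x <= \int[mu]_x v x)%E.
  move=> u0 v0 uv; rewrite !ge0_integralTE//.
  apply: ge_ereal_sup => _ [h hu <-].
  apply: ereal_sup_ubound; exists (proj_nnsfun h (measurableC mN)).
    move=> x; rewrite /= mindicE; have [Nx|Nx] := pselect (N x).
      by rewrite memNset ?mulr0 ?v0//= => /(_ Nx).
    by rewrite mem_set//= mulr1 -uv.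
  rewrite -[RHS](_ : sintegral mu (h \_ setT) = _); last by rewrite patch_setT.
  rewrite -integral_nnsfun// (ge0_negligible_integral mN)//=; last 2 first.
    exact/measurable_EFinP.
    by move=> x _; rewrite lee_fin; exact: fun_ge0.
  rewrite setTD integral_nnsfun; last exact: measurableC.
  by rewrite (mrestrict _ (measurableC mN)).
have ge0_eq (u v : T -> \bar R) : (forall x, 0 <= u x)%E ->
    (forall x, 0 <= v x)%E -> (forall x, ~ N x -> u x = v x) ->
    (\int[mu]_x u x = \int[mu]_x v x)%E.
  move=> u0 v0 uv; apply/eqP; rewrite eq_le !ge0_le// => x Nx.
  by rewrite uv.
move=> fg; rewrite integralE [RHS]integralE; congr (_ - _)%E;
  by apply: ge0_eq => // x Nx; rewrite ?(funeposE, funenegE) fg.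
Qed.

End null_integral.

(** A zero integral would force [f] to vanish almost everywhere, and the whole space would be
    covered by two null sets. *)
Lemma integral_gt0 {d} {T : measurableType d} {R : realType}
    (mu : {measure set T -> \bar R}) (N : set T) (f : T -> \bar R) :
  measurable N -> mu N = 0%E -> mu setT != 0%E ->
  measurable_fun setT f -> (forall x, 0 <= f x)%E ->
  (forall x, ~ N x -> 0 < f x)%E -> (0 < \int[mu]_x f x)%E.
Proof.
move=> mN N0 muT mf f0 fN; rewrite lt0e integral_ge0// andbT.
apply: contra_neqN muT => /eqP If.
have : (\int[mu]_x `|f x| = 0)%E.
  by rewrite -If; apply: eq_integral => x _; rewrite gee0_abs.
move/(ae_eq_integral_abs _ measurableT mf) => [N' [mN' N'0 fN']].
apply: (@subset_measure0 _ _ _ _ _ (N' `|` N)) => //.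
- exact: measurableU.
- move=> x _; have [Nx|Nx] := pselect (N x); [by right|left].
  by apply: fN' => /= /(_ I) fx0; have := fN _ Nx; rewrite fx0 ltxx.
- exact: null_set_setU.
Qed.

(** * Reflection of Lebesgue measure and the first moment of a normal density *)

Section reflection.
Context {R : realType}.
Local Notation leb := (@lebesgue_measure R).

Lemma pushforward_lebesgue_reflect (m : R) (A : set (measurableTypeR R)) :
  measurable A ->
  pushforward leb (fun x => 2 * m - x : measurableTypeR R) A = leb A.
Proof.
move=> mA; apply/esym/lebesgue_measure_unique => //=.
  exact: measurable_funB.
move=> _ _ [[a b]] _ <-.
rewrite /pushforward (_ : _ @^-1` _ = `[2 * m - b, 2 * m - a[%classic).
  rewrite !lebesgue_measure_itv/= !lte_fin ltrD2l ltrN2.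
  by case: ifP => // _; rewrite -!EFinB; congr EFin; lra.
apply/seteqP; split => x; rewrite /= !in_itv/= => /andP[xa xb];
  apply/andP; split; lra.
Qed.

Lemma ge0_integral_reflect (m : R) (f : R -> \bar R) :
  measurable_fun setT f -> (forall x, 0 <= f x)%E ->
  (\int[leb]_x f x = \int[leb]_x f (2 * m - x)%R)%E.
Proof.
move=> mf f0.
have mr : measurable_fun setT (fun x : R => 2 * m - x : measurableTypeR R).
  exact: measurable_funB.
transitivity (\int[pushforward leb
    (fun x => (2 * m - x)%R : measurableTypeR R)]_x f x)%E.
  apply: eq_measure_integral => A mA _.
  exact/esym/pushforward_lebesgue_reflect.
by rewrite ge0_integral_pushforward//= => x _; exact: f0.
Qed.

(** Reflection about [m] exchanges the positive and negative parts, whose integrals are then equal;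
    integrability makes them finite, so that they cancel. *)
Lemma integral_odd_eq0 (m : R) (f : R -> R) :
  leb.-integrable setT (EFin \o f) -> (forall x, f (2 * m - x) = - f x) ->
  (\int[leb]_x (f x)%:E = 0)%E.
Proof.
move=> fi fodd; have mf := measurable_int _ fi.
rewrite integralE (ge0_integral_reflect m)//; last exact: measurable_funepos.
rewrite [X in (X - _)%E](_ : _ = \int[leb]_x (EFin \o f)^\- x)%E; last first.
  by apply: eq_integral => x _; rewrite funeposE funenegE/= fodd EFinN.
rewrite subee//; apply: integrable_fin_num => //; exact: integrable_funeneg.
Qed.

(* [|u| <= C exp(u^2 / 4 s^2)] turns the first moment into a multiple of a
   wider Gaussian density. *)
Lemma integrable_center_normal_pdf (m s : R) : 0 < s ->
  leb.-integrable setT (fun x => ((x - m) * normal_pdf m s x)%:E).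
Proof.
move=> s0.
have mpdf t : measurable_fun setT (normal_pdf m t).
  exact: measurable_normal_pdf.
(* With r^2 = 2 s^2, the exponential of the density of deviation [s] is the square of the one for
   [r], called [E] below. One factor [E] absorbs |u|, the other rebuilds the wider density, and [k]
   is the resulting constant. *)
pose r := Num.sqrt 2 * s.
have r0 : 0 < r by rewrite mulr_gt0// sqrtr_gt0.
have r2 : r ^+ 2 = 2 * s ^+ 2 by rewrite exprMn sqr_sqrtr.
pose k := 2 * s * (normal_peak s / normal_peak r).
have pr0 : 0 < normal_peak r by rewrite normal_peak_gt0// gt_eqF.
have ps0 : 0 < normal_peak s by rewrite normal_peak_gt0// gt_eqF.
apply: (@le_integrable _ _ _ leb setT _ _ (fun x => k%:E * (normal_pdf m r x)%:E)%E) => //.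
- apply/measurable_EFinP/measurable_funM; last exact: mpdf.
  exact: measurable_funB.
- move=> x _; rewrite -EFinM !abse_EFin lee_fin.
  rewrite !normal_pdfE ?gt_eqF// /k /normal_fun r2.
  set u := x - m.
  have -> : - u ^+ 2 / (s ^+ 2 *+ 2) =
    - u ^+ 2 / (2 * s ^+ 2 *+ 2) + - u ^+ 2 / (2 * s ^+ 2 *+ 2).
    by field; rewrite gt_eqF.
  rewrite expRD; set E := expR _.
  have E0 : 0 < E by exact: expR_gt0.
  (* By exp x >= 1 + x it is enough that v <= 2 s + v^2 / (2 s) for v = |u|, that is 4 s^2 - 2 s v +
     v^2 >= 0, a quadratic form of negative discriminant. *)
  have uE : `|u| * E <= 2 * s.
    rewrite -ler_pdivlMr// /E -expRN.
    apply: (@le_trans _ _ (2 * s * (1 + u ^+ 2 / (2 * s ^+ 2 *+ 2)))).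
      rewrite -(normr_id u) -(real_normK (num_real u)); set v := `|u|.
      rewrite -subr_ge0 (_ : _ - _ = (2 * s)^-1 * (4 * s ^+ 2 - 2 * s * v + v ^+ 2)).
        apply: mulr_ge0; first by rewrite invr_ge0 mulr_ge0// ltW.
        by have := sqr_ge0 (2 * s - v); have := sqr_ge0 s; have := sqr_ge0 v; nra.
      by rewrite normr_id -/v; field; rewrite gt_eqF.
    rewrite ler_pM2l ?mulr_gt0// mulNr opprK; exact: expR_ge1Dx.
  rewrite [X in _ <= `|X|](_ : _ = 2 * s * (normal_peak s * E)); last first.
    by field; rewrite gt_eqF.
  rewrite (_ : u * _ = (u * E) * (normal_peak s * E)); last by ring.
  rewrite (normrM (u * E)) (normrM (2 * s)) ler_wpM2r// normrM.
  rewrite (ger0_norm (ltW E0)).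
  by apply: le_trans uE _; exact: ler_norm.
- apply: integrableZl => //; exact: integrable_normal_pdf.
Qed.

Lemma integrable_id_normal_pdf (m s : R) : 0 < s ->
  leb.-integrable setT (fun x => (x * normal_pdf m s x)%:E).
Proof.
move=> s0.
rewrite (_ : (fun x => _) = (fun x => ((x - m) * normal_pdf m s x)%:E
   + m%:E * (normal_pdf m s x)%:E)%E); last first.
  by apply/funext => x; rewrite -EFinM -EFinD; congr EFin; ring.
apply: integrableD => //; first exact: integrable_center_normal_pdf.
by apply: integrableZl => //; exact: integrable_normal_pdf.
Qed.

Lemma integral_id_normal_pdf (m s : R) : 0 < s ->
  (\int[leb]_x (x * normal_pdf m s x)%:E = m%:E)%E.
Proof.
move=> s0.
transitivity (\int[leb]_x (((x - m) * normal_pdf m s x)%:E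
   + m%:E * (normal_pdf m s x)%:E))%E.
  by apply: eq_integral => x _; rewrite -EFinM -EFinD; congr EFin; ring.
rewrite integralD//=; last 2 first.
  exact: integrable_center_normal_pdf.
  by apply: integrableZl => //; exact: integrable_normal_pdf.
rewrite (integral_odd_eq0 m); last 2 first.
  exact: integrable_center_normal_pdf.
  move=> x; rewrite !normal_pdfE ?gt_eqF// /normal_fun.
  rewrite (_ : 2 * m - x - m = - (x - m)); last by ring.
  by rewrite sqrrN mulNr.
rewrite integralZl//; last exact: integrable_normal_pdf.
by rewrite integral_normal_pdf mule1 add0e.
Qed.

End reflection.

(** * Gaussian integrals under an orthogonal design *)

Section product_integral.
Context {R : realType}.
Local Notation leb := (@lebesgue_measure R).

(** Induction on the number of coordinates already integrated: their factors have become constants,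
    so each further integral is one-dimensional and linearity suffices. *)
Lemma iint_prod (K k : nat) (c : R) (psi : 'I_K -> R -> R) (v : 'I_K -> R) :
  (k <= K)%N -> (forall j, leb.-integrable setT (EFin \o psi j)) ->
  iint k (fun b => (c * \prod_(j < K) psi j (b j))%:E) v =
  (c * \prod_(j < K) (if (j < k)%N then \int[leb]_x psi j x
                      else psi j (v j)))%:E.
Proof.
move=> kK ipsi; elim: k v kK => [|k IHk] v kK /=.
  by congr (_ * _)%:E; apply: eq_bigr.
pose j0 := Ordinal kK.
pose r := \prod_(j < K | j != j0) (if (j < k)%N then \int[leb]_x psi j x
                      else psi j (v j)).
transitivity (\int[leb]_x ((c * r)%:E * (psi j0 x)%:E))%E.
  apply: eq_integral => x _; rewrite IHk ?(ltnW kK)// -EFinM; congr EFin.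
  rewrite (bigD1 j0)//= ltnn /upd eqxx -[RHS]mulrA [r * _]mulrC.
  congr (_ * (_ * _)).
  by apply: eq_bigr => j jj0; rewrite -val_eqE/= in jj0; rewrite (negbTE jj0).
rewrite integralZl//; last exact: ipsi.
rewrite -(fineK (integrable_fin_num measurableT (ipsi j0))) -EFinM.
congr EFin; rewrite (bigD1 j0)//= ltnS leqnn -mulrA [r * _]mulrC.
congr (_ * (_ * _)); apply: eq_bigr => j jj0.
by rewrite ltnS [(j <= k)%N]leq_eqVlt; rewrite -val_eqE/= in jj0; rewrite (negbTE jj0).
Qed.

End product_integral.

Section gaussian_posterior.
Context {R : realType}.
Local Notation leb := (@lebesgue_measure R).
Implicit Types (n K : nat).

(** The least squares coefficient when X^t X = n I; at y = Y* it is the z_k of the overview. *)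
Definition coef {n K} (X : 'M[R]_(n, K)) (y : 'cV[R]_n) (k : 'I_K) : R :=
  (\sum_(i < n) X i k * y i ord0) / n%:R.

Definition sqnorm {n} (y : 'cV[R]_n) : R := \sum_(i < n) y i ord0 ^+ 2.

(** Pythagorean form of the residual sum of squares, valid when X^t X = n I. It is the quantity that
    the exponents of the evidence produce. *)
Definition residual {n K} (X : 'M[R]_(n, K)) (y : 'cV[R]_n) : R :=
  sqnorm y - n%:R * \sum_(k < K) coef X y k ^+ 2.

(* [amp z g s] and [evidence] are the Gaussian integrals left after completing
   the square coordinatewise: the posterior of [b k] given (gamma, sigma^2) is
   normal with mean [z g / (g + s)] and variance [g s / (g + s)]. *)
Definition amp (z g s : R) : R :=
  normal_peak (Num.sqrt g) / normal_peak (Num.sqrt (g * s / (g + s)))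
  * expR (z ^+ 2 * g / (2 * s * (g + s))).

Definition evidence {K} n (q : R) (z g : 'I_K -> R) (s : R) : R :=
  normal_peak (Num.sqrt (s * n%:R)) ^+ n * expR (- q / (2 * s * n%:R))
  * \prod_(k < K) amp (z k) (g k) s.

(** Completing the square in [x]. The exponential on the left is what one coordinate of beta
    contributes to the likelihood, and the second factor is its prior density. *)
Lemma tilted_gaussE (z g s x : R) : 0 < g -> 0 < s ->
  expR (x * z / s - x ^+ 2 / (2 * s)) * gauss 0 g x =
  amp z g s * normal_pdf (z * g / (g + s)) (Num.sqrt (g * s / (g + s))) x.
Proof.
move=> g0 s0; have gs0 : 0 < g + s by rewrite addr_gt0.
have v0 : 0 < g * s / (g + s) by rewrite divr_gt0// mulr_gt0.
rewrite /gauss !normal_pdfE ?gt_eqF ?sqrtr_gt0// /normal_fun /amp.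
have p0 : normal_peak (Num.sqrt (g * s / (g + s))) != 0.
  by rewrite gt_eqF// normal_peak_gt0// gt_eqF// sqrtr_gt0.
rewrite mulrCA -expRD [RHS]mulrACA -expRD divfK//; congr (_ * expR _).
rewrite !sqr_sqrtr ?ltW//; field.
by rewrite !gt_eqF.
Qed.

Lemma integrable_tilted_gauss (z g s : R) : 0 < g -> 0 < s ->
  leb.-integrable setT
    (EFin \o (fun x => expR (x * z / s - x ^+ 2 / (2 * s)) * gauss 0 g x)).
Proof.
move=> g0 s0.
rewrite (_ : _ \o _ = fun x => (amp z g s)%:E *
  (normal_pdf (z * g / (g + s)) (Num.sqrt (g * s / (g + s))) x)%:E)%E.
  by apply: integrableZl => //; exact: integrable_normal_pdf.
by apply/funext => x /=; rewrite tilted_gaussE.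
Qed.

Lemma integral_tilted_gauss (z g s : R) : 0 < g -> 0 < s ->
  \int[leb]_x (expR (x * z / s - x ^+ 2 / (2 * s)) * gauss 0 g x) = amp z g s.
Proof.
move=> g0 s0; rewrite /Rintegral.
under eq_integral do rewrite tilted_gaussE// EFinM.
rewrite integralZl//; last exact: integrable_normal_pdf.
by rewrite integral_normal_pdf mule1.
Qed.

Lemma integrable_id_tilted_gauss (z g s : R) : 0 < g -> 0 < s ->
  leb.-integrable setT
    (EFin \o (fun x => x * (expR (x * z / s - x ^+ 2 / (2 * s)) * gauss 0 g x))).
Proof.
move=> g0 s0; have gs0 : 0 < g + s by rewrite addr_gt0.
rewrite (_ : _ \o _ = fun x => (amp z g s)%:E * (x *
  normal_pdf (z * g / (g + s)) (Num.sqrt (g * s / (g + s))) x)%:E)%E.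
  apply: integrableZl => //; apply: integrable_id_normal_pdf.
  by rewrite sqrtr_gt0 divr_gt0// mulr_gt0.
by apply/funext => x /=; rewrite tilted_gaussE// -EFinM mulrCA.
Qed.

Lemma integral_id_tilted_gauss (z g s : R) : 0 < g -> 0 < s ->
  \int[leb]_x (x * (expR (x * z / s - x ^+ 2 / (2 * s)) * gauss 0 g x)) =
  z * (g / (g + s)) * amp z g s.
Proof.
move=> g0 s0; have gs0 : 0 < g + s by rewrite addr_gt0.
have v0 : 0 < Num.sqrt (g * s / (g + s)).
  by rewrite sqrtr_gt0 divr_gt0// mulr_gt0.
rewrite /Rintegral.
under eq_integral do rewrite tilted_gaussE// mulrCA EFinM.
rewrite integralZl//; last exact: integrable_id_normal_pdf.
by rewrite integral_id_normal_pdf//= mulrC mulrA.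
Qed.

Lemma sum_sqr_residual n K (X : 'M[R]_(n, K)) (y : 'cV[R]_n) (b : 'I_K -> R) :
  (0 < n)%N -> X^T *m X = n%:R%:M ->
  \sum_(i < n) (y i ord0 - \sum_(k < K) X i k * b k) ^+ 2 =
  sqnorm y - 2 * n%:R * (\sum_(k < K) b k * coef X y k)
  + n%:R * \sum_(k < K) b k ^+ 2.
Proof.
move=> n0 XX; have nN0 : n%:R != 0 :> R by rewrite pnatr_eq0 -lt0n.
have XXE k l : \sum_(i < n) X i k * X i l = n%:R * (k == l)%:R.
  have /matrixP/(_ k l) := XX; rewrite !mxE mulr_natr => <-.
  by apply: eq_bigr => i _; rewrite mxE.
under eq_bigr do rewrite sqrrB.
rewrite big_split/= sumrB; congr (_ - _ + _).
  rewrite sumrMnl -[LHS]mulr_natl -mulrA; congr (_ * _).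
  rewrite mulr_sumr; under eq_bigr do rewrite mulr_sumr.
  rewrite exchange_big/=; apply: eq_bigr => k _.
  transitivity (b k * \sum_(i < n) X i k * y i ord0).
    by rewrite mulr_sumr; apply: eq_bigr => i _; ring.
  by rewrite /coef; field.
under eq_bigr do rewrite expr2 big_distrlr/=.
rewrite exchange_big/= mulr_sumr; apply: eq_bigr => k _.
rewrite exchange_big/= (bigD1 k)//= [X in _ + X]big1 ?addr0; last first.
  move=> l lk; transitivity (b k * b l * \sum_(i < n) X i k * X i l).
    by rewrite mulr_sumr; apply: eq_bigr => i _; ring.
  by rewrite XXE eq_sym (negbTE lk) !mulr0.
transitivity (b k * b k * \sum_(i < n) X i k * X i k).
  by rewrite mulr_sumr; apply: eq_bigr => i _; ring.
by rewrite XXE eqxx mulr1 mulrC.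
Qed.

(** The variance inflation lambda_n = n cancels the n of X^t X = n I: each coordinate is seen with
    variance [s], whatever n. This is why the shrinkage factor does not degenerate as n grows. *)
Lemma likE n K (X : 'M[R]_(n, K)) (y : 'cV[R]_n) (b : 'I_K -> R) (s : R) :
  (0 < n)%N -> X^T *m X = n%:R%:M -> 0 < s ->
  lik X n%:R y b s =
  normal_peak (Num.sqrt (s * n%:R)) ^+ n * expR (- sqnorm y / (2 * s * n%:R))
  * \prod_(k < K) expR (b k * coef X y k / s - b k ^+ 2 / (2 * s)).
Proof.
move=> n0 XX s0; have nN0 : n%:R != 0 :> R by rewrite pnatr_eq0 -lt0n.
have sn0 : 0 < s * n%:R by rewrite mulr_gt0// ltr0n.
rewrite /lik.
under eq_bigr => i _.
  rewrite /gauss normal_pdfE ?gt_eqF ?sqrtr_gt0// /normal_fun.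
  rewrite sqr_sqrtr ?ltW// mulNr.
  over.
rewrite big_split/= prodr_const card_ord -mulrA; congr (_ * _).
rewrite -!expR_sum -expRD; congr expR.
rewrite sumrN -mulr_suml sum_sqr_residual// big_split/= sumrN -!mulr_suml.
by field; rewrite nN0 gt_eqF.
Qed.

Lemma intRK_evidence n K (X : 'M[R]_(n, K)) (y : 'cV[R]_n) (g : 'I_K -> R)
    (s : R) :
  (0 < n)%N -> X^T *m X = n%:R%:M -> 0 < s -> (forall k, 0 < g k) ->
  intRK (fun b => (lik X n%:R y b s * prior_beta b g)%:E) =
  (evidence n (sqnorm y) (coef X y) g s)%:E.
Proof.
move=> n0 XX s0 g0; rewrite /intRK.
pose psi (j : 'I_K) x :=
  expR (x * coef X y j / s - x ^+ 2 / (2 * s)) * gauss 0 (g j) x.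
pose c := normal_peak (Num.sqrt (s * n%:R)) ^+ n
  * expR (- sqnorm y / (2 * s * n%:R)).
rewrite (_ : (fun b => _) = (fun b => (c * \prod_(j < K) psi j (b j))%:E)).
  rewrite iint_prod//; last by move=> j; exact: integrable_tilted_gauss.
  congr (_ * _)%:E; apply: eq_bigr => j _.
  by rewrite ltn_ord integral_tilted_gauss.
apply/funext => b; congr EFin; rewrite likE// -/c /prior_beta.
by rewrite -[LHS]mulrA -big_split.
Qed.

Lemma intRK_posterior_mean n K (X : 'M[R]_(n, K)) (y : 'cV[R]_n)
    (g : 'I_K -> R) (s : R) (k : 'I_K) :
  (0 < n)%N -> X^T *m X = n%:R%:M -> 0 < s -> (forall k, 0 < g k) ->
  intRK (fun b => (b k * lik X n%:R y b s * prior_beta b g)%:E) =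
  (coef X y k * (g k / (g k + s))
   * evidence n (sqnorm y) (coef X y) g s)%:E.
Proof.
move=> n0 XX s0 g0; rewrite /intRK.
pose psi (j : 'I_K) x :=
  expR (x * coef X y j / s - x ^+ 2 / (2 * s)) * gauss 0 (g j) x.
(* The extra factor [b k] affects a single coordinate, where the integral becomes a first moment. *)
pose psik (j : 'I_K) x := if j == k then x * psi j x else psi j x.
pose c := normal_peak (Num.sqrt (s * n%:R)) ^+ n
  * expR (- sqnorm y / (2 * s * n%:R)).
rewrite (_ : (fun b => _) = (fun b => (c * \prod_(j < K) psik j (b j))%:E)).
  rewrite iint_prod//; last first.
    move=> j; rewrite /psik; case: (j == k).
      exact: integrable_id_tilted_gauss.
    exact: integrable_tilted_gauss.
  congr EFin; rewrite /evidence -/c [RHS]mulrCA; congr (_ * _).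
  rewrite (bigD1 k)//= [in RHS](bigD1 k)//= ltn_ord mulrA; congr (_ * _).
    rewrite /psik eqxx integral_id_tilted_gauss//.
  apply: eq_bigr => j jk; rewrite ltn_ord /psik (negbTE jk).
  by rewrite integral_tilted_gauss.
apply/funext => b; congr EFin; rewrite likE// -/c.
rewrite -mulrA -mulrA /prior_beta -big_split/= mulrCA; congr (_ * _).
rewrite (bigD1 k)//= [in RHS](bigD1 k)//= /psik eqxx mulrA; congr (_ * _).
by apply: eq_bigr => j jk; rewrite (negbTE jk).
Qed.

End gaussian_posterior.

(** * Positivity, uniform bound and measurability of the evidence *)

Section evidence_bounds.
Context {R : realType}.
Implicit Types (n K : nat).

Lemma normal_peak_sqrt (v : R) : 0 <= v ->
  normal_peak (Num.sqrt v) = (Num.sqrt (v * pi *+ 2))^-1.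
Proof. by move=> v0; rewrite /normal_peak sqr_sqrtr. Qed.

Lemma amp_gt0 (z g s : R) : 0 < g -> 0 < s -> 0 < amp z g s.
Proof.
move=> g0 s0; rewrite mulr_gt0 ?expR_gt0// divr_gt0// normal_peak_gt0//.
  by rewrite gt_eqF// sqrtr_gt0.
by rewrite gt_eqF// sqrtr_gt0 divr_gt0 ?mulr_gt0 ?addr_gt0.
Qed.

Lemma amp_ge0 (z g s : R) : 0 <= amp z g s.
Proof. by rewrite mulr_ge0 ?expR_ge0// divr_ge0 ?normal_peak_ge0. Qed.

(** The ratio of peaks is at most 1 because the conditional variance g s / (g + s) does not exceed
    the prior variance g, and the exponent only loses the factor g / (g + s) <= 1. The resulting
    bound is free of gamma. *)
Lemma amp_le (z g s : R) : 0 < g -> 0 < s ->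
  amp z g s <= expR (z ^+ 2 / (2 * s)).
Proof.
move=> g0 s0; have gs0 : 0 < g + s by rewrite addr_gt0.
have v0 : 0 < g * s / (g + s) by rewrite divr_gt0// mulr_gt0.
rewrite /amp -[leRHS]mul1r; apply: ler_pM; rewrite ?expR_ge0//.
- by rewrite divr_ge0 ?normal_peak_ge0.
- have p0 : 0 < normal_peak (Num.sqrt (g * s / (g + s))).
    by rewrite normal_peak_gt0// gt_eqF// sqrtr_gt0.
  rewrite ler_pdivrMr// mul1r (normal_peak_sqrt _ (ltW g0)).
  rewrite (normal_peak_sqrt _ (ltW v0)) lef_pV2 ?posrE ?sqrtr_gt0.
  + rewrite ler_wsqrtr// lerMn2r/= ler_pM2r ?pi_gt0//.
    by rewrite ler_pdivrMr// ler_pM2l// lerDr ltW.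
  + by rewrite pmulrn_lgt0// mulr_gt0// pi_gt0.
  + by rewrite pmulrn_lgt0// mulr_gt0// pi_gt0.
- rewrite ler_expR -mulrA ler_wpM2l ?sqr_ge0//.
  by rewrite ler_pdivrMr ?mulr_gt0// mulrA mulVf ?mul1r ?gt_eqF ?mulr_gt0// lerDl ltW.
Qed.

Lemma evidence_ge0 n K (q : R) (z g : 'I_K -> R) (s : R) :
  0 <= evidence n q z g s.
Proof.
rewrite mulr_ge0 ?prodr_ge0// => [|k _]; last exact: amp_ge0.
by rewrite mulr_ge0 ?expR_ge0// exprn_ge0// normal_peak_ge0.
Qed.

Lemma evidence_gt0 n K (q : R) (z g : 'I_K -> R) (s : R) :
  (0 < n)%N -> 0 < s -> (forall k, 0 < g k) -> 0 < evidence n q z g s.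
Proof.
move=> n0 s0 g0; rewrite mulr_gt0 ?prodr_gt0// => [|k _]; last exact: amp_gt0.
rewrite mulr_gt0 ?expR_gt0// exprn_gt0// normal_peak_gt0// gt_eqF// sqrtr_gt0.
by rewrite mulr_gt0// ltr0n.
Qed.

(* A positive residual makes [s^(-n/2) exp(- a / (2 n s))] bounded near [s = 0]. *)
Lemma evidence_le n K (q : R) (z g : 'I_K -> R) (s : R)
    (a := q - n%:R * \sum_(k < K) z k ^+ 2) :
  (0 < n)%N -> 0 < a -> 0 < s -> (forall k, 0 < g k) ->
  evidence n q z g s <= (Num.min 1 (a / (2 * n%:R ^+ 2)))^-1 ^+ n.
Proof.
move=> n0 a0 s0 g0; have n0R : 0 < n%:R :> R by rewrite ltr0n.
(* Chosen so that exp(- a / (2 n s)) = exp(- kap / s) ^ n: everything is then compared under an n-th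
   power. *)
set kap := a / (2 * n%:R ^+ 2).
have kap0 : 0 < kap by rewrite divr_gt0// mulr_gt0// exprn_gt0.
have m0 : 0 < Num.min 1 kap by rewrite lt_min ltr01.
have sn0 : 0 < s * n%:R by rewrite mulr_gt0.
(* The peak is at most u = s^(-1/2), and u <= 1 + u^2 removes the square root. *)
have peak_le : normal_peak (Num.sqrt (s * n%:R)) <= 1 + s^-1.
  rewrite (normal_peak_sqrt _ (ltW sn0)).
  apply: (@le_trans _ _ (Num.sqrt s)^-1).
    rewrite lef_pV2 ?posrE ?sqrtr_gt0// ?pmulrn_lgt0 ?mulr_gt0 ?pi_gt0//.
    rewrite ler_wsqrtr// -mulr_natr -!mulrA -[leLHS]mulr1 ler_pM2l//.
    have n1 : 1 <= n%:R :> R by rewrite ler1n.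
    by have := @pi_ge2 R; nra.
  rewrite -(sqr_sqrtr (ltW s0)) sqrtr_sqr ger0_norm// -exprVn.
  by set u := (Num.sqrt s)^-1; have := sqr_ge0 (u - 1); have := sqr_ge0 u; nra.
have prod_le : \prod_(k < K) amp (z k) (g k) s <=
    expR (\sum_(k < K) z k ^+ 2 / (2 * s)).
  rewrite expR_sum; apply: ler_prod => k _; rewrite amp_ge0/=.
  exact: amp_le.
rewrite /evidence.
apply: (@le_trans _ _ ((1 + s^-1) ^+ n * expR (- (kap / s)) ^+ n)).
  rewrite -mulrA; apply: ler_pM => //.
  - by rewrite exprn_ge0// normal_peak_ge0.
  - rewrite mulr_ge0 ?expR_ge0// prodr_ge0// => k _; exact: amp_ge0.
  - by rewrite lerXn2r ?nnegrE ?normal_peak_ge0// addr_ge0// invr_ge0 ltW.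
  - apply: (@le_trans _ _ (expR (- q / (2 * s * n%:R)) *
      expR (\sum_(k < K) z k ^+ 2 / (2 * s)))).
      by rewrite ler_wpM2l ?expR_ge0.
    rewrite -expRD -expRM_natl -mulr_suml ler_expR le_eqVlt; apply/orP; left.
    by apply/eqP; rewrite /kap /a; field; rewrite !gt_eqF.
rewrite -exprMn lerXn2r ?nnegrE ?invr_ge0 ?(ltW m0)//.
  by rewrite mulr_ge0 ?expR_ge0// addr_ge0// invr_ge0 ltW.
(* With m = min(1, kap), exp(kap / s) >= 1 + kap / s >= m (1 + 1 / s). *)
rewrite expRN ler_pdivrMr ?expR_gt0// mulrC -ler_pdivrMr ?invr_gt0// invrK.
apply: le_trans (expR_ge1Dx _).
have si0 : 0 < s^-1 by rewrite invr_gt0.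
have : Num.min 1 kap <= 1 by rewrite ge_min lexx.
have : Num.min 1 kap <= kap by rewrite ge_min lexx orbT.
by nra.
Qed.

Lemma measurable_fun_evidence {d} {T : measurableType d} n K (q : T -> R)
    (z g : 'I_K -> T -> R) (s : T -> R) :
  measurable_fun setT q -> (forall k, measurable_fun setT (z k)) ->
  (forall k, measurable_fun setT (g k)) -> measurable_fun setT s ->
  measurable_fun setT (fun x => evidence n (q x) (z^~ x) (g^~ x) (s x)).
Proof.
move=> mq mz mg ms.
have mV (f : T -> R) : measurable_fun setT f ->
    measurable_fun setT (fun x => (f x)^-1).
  by move=> mf; exact: (measurableT_comp (measurable_invr R) mf).
have mS (f : T -> R) : measurable_fun setT f ->
    measurable_fun setT (fun x => Num.sqrt (f x)).
  by move=> mf; exact: (measurableT_comp (measurable_sqrtr R) mf).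
have mE (f : T -> R) : measurable_fun setT f ->
    measurable_fun setT (fun x => expR (f x)).
  by move=> mf; apply: measurableT_comp => //; exact: measurable_expR.
have mN (f : T -> R) : measurable_fun setT f ->
    measurable_fun setT (fun x => - f x).
  by move=> mf; exact: measurable_funN.
have mP (f : T -> R) : measurable_fun setT f ->
    measurable_fun setT (fun x => normal_peak (Num.sqrt (f x))).
  move=> mf; rewrite /normal_peak; apply/mV; apply/mS.
  apply: (@measurableT_comp _ _ _ _ _ _ (fun y : R => y *+ 2)).
    exact: natmul_measurable.
  by apply: measurable_funM => //; apply: measurable_funX; exact/mS.
rewrite /evidence; apply: measurable_funM.
  apply: measurable_funM.
    by apply: measurable_funX; apply/mP; exact: measurable_funM.
  apply/mE; apply: measurable_funM; first exact/mN.
  by apply/mV; do 2 (apply: measurable_funM => //).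
apply: measurable_prod => k _; rewrite /amp; apply: measurable_funM.
  apply: measurable_funM; first exact/mP.
  apply/mV; apply/mP; apply: measurable_funM; first exact: measurable_funM.
  by apply/mV; exact: measurable_funD.
apply/mE; apply: measurable_funM.
  by apply: measurable_funM => //; exact: measurable_funX.
apply/mV; apply: measurable_funM; first exact: measurable_funM.
exact: measurable_funD.
Qed.

End evidence_bounds.

(** * The posterior mean as a shrunken least squares coefficient *)

Section posterior_mean.
Context {R : realType} {dG : measure_display} {TG : measurableType dG}.
Variables (piG : probability TG R) (mu : probability R R).
Variables (K : nat) (gam : TG -> 'I_K -> R) (eta0 sbar : R).
Hypothesis mgam : forall k, measurable_fun setT (fun t => gam t k).
Hypothesis eta0_gt0 : 0 < eta0.
Hypothesis sbar_gt0 : 0 < sbar.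
Variables (N1 : set TG) (N2 : set R).
Hypotheses (mN1 : measurable N1) (mN2 : measurable N2).
Hypotheses (N10 : piG N1 = 0%E) (N20 : mu N2 = 0%E).
Hypothesis gamN1 : forall t, ~ N1 t -> forall k, eta0 <= gam t k.
Hypothesis sN2 : forall s, ~ N2 s -> 0 < s <= sbar.
Variables (n : nat) (X : 'M[R]_(n, K)).
Hypotheses (n_gt0 : (0 < n)%N) (XX : X^T *m X = n%:R%:M).

Local Notation nu := ((piG \x mu)%E : probability (TG * R)%type R).

Let N := (N1 `*` setT) `|` (setT `*` N2).

Let mN : measurable N.
Proof. by apply: measurableU; exact: measurableX. Qed.

Let N0 : nu N = 0%E.
Proof.
apply: null_set_setU; try exact: measurableX.
  apply: etrans (product_measure1E piG mu mN1 measurableT) _.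
  by rewrite [X in (X * _)%E]N10 mul0e.
apply: etrans (product_measure1E piG mu measurableT mN2) _.
by rewrite [X in (_ * X)%E]N20 mule0.
Qed.

Let nuT : nu setT = 1%E. Proof. exact: probability_setT. Qed.

Let NP (p : TG * R) : ~ N p ->
  (forall k, eta0 <= gam p.1 k) /\ 0 < p.2 <= sbar.
Proof.
case: p => t s /= /not_orP[N1t N2s]; split.
  by apply: gamN1 => N1t'; apply: N1t.
by apply: sN2 => N2s'; apply: N2s.
Qed.

Let gam_gt0 t k : ~ N1 t -> 0 < gam t k.
Proof. by move=> N1t; apply: lt_le_trans eta0_gt0 _; exact: gamN1. Qed.

Definition weight (y : 'cV[R]_n) (p : TG * R) : R :=
  evidence n (sqnorm y) (coef X y) (gam p.1) p.2.

(* The absolute value keeps the factor nonnegative off the support of the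
   prior, where it is irrelevant. *)
Definition shrink (k : 'I_K) (p : TG * R) : R :=
  `|gam p.1 k / (gam p.1 k + p.2)|.

(** The factor rho_k of the overview: the mean of [shrink] under the posterior of (gamma, sigma^2),
    whose density with respect to the prior [nu] is proportional to [weight]. *)
Definition shrink_mean (y : 'cV[R]_n) (k : 'I_K) : R :=
  fine (\int[nu]_p (shrink k p * weight y p)%:E)%E
  / fine (\int[nu]_p (weight y p)%:E)%E.

Let weight_ge0 y p : 0 <= weight y p. Proof. exact: evidence_ge0. Qed.

Let shrink_ge0 k p : 0 <= shrink k p. Proof. exact: normr_ge0. Qed.

Let mgam1 k : measurable_fun setT (fun p : TG * R => gam p.1 k).
Proof. by apply: (measurableT_comp (mgam k)); exact: measurable_fst. Qed.

Lemma measurable_shrink k : measurable_fun setT (shrink k).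
Proof.
apply: measurableT_comp => //; apply: measurable_funM => //.
apply: (measurableT_comp (measurable_invr R)); exact: measurable_funD.
Qed.

Lemma measurable_weight {d} {T : measurableType d} (Y : T -> 'cV[R]_n) :
  (forall i, measurable_fun setT (fun w => Y w i ord0)) ->
  measurable_fun setT (fun wp : T * (TG * R) => weight (Y wp.1) wp.2).
Proof.
move=> mY; apply: measurable_fun_evidence.
- apply: measurable_sum => i; apply: measurable_funX.
  by apply: (measurableT_comp (mY i)); exact: measurable_fst.
- move=> k; apply: measurable_funM => //; apply: measurable_sum => i.
  apply: measurable_funM => //.
  by apply: (measurableT_comp (mY i)); exact: measurable_fst.
- move=> k; apply: (measurableT_comp (mgam1 k)); exact: measurable_snd.
- by apply: (measurableT_comp measurable_snd); exact: measurable_snd.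
Qed.

Let mweight y : measurable_fun setT (weight y).
Proof. exact: measurable_fun_evidence. Qed.

Let mshrinkw y k : measurable_fun setT (fun p => shrink k p * weight y p).
Proof. by apply: measurable_funM => //; exact: measurable_shrink. Qed.

(** Numerator and denominator are integrals of nonnegative functions, jointly measurable in the
    sample point and the parameters, so Tonelli applies to each. *)
Lemma measurable_shrink_mean {d} {T : measurableType d} (Y : T -> 'cV[R]_n)
    (k : 'I_K) :
  (forall i, measurable_fun setT (fun w => Y w i ord0)) ->
  measurable_fun setT (fun w => shrink_mean (Y w) k).
Proof.
move=> mY.
have mfubini (h : T * (TG * R) -> R) : measurable_fun setT h ->
    (forall wp, 0 <= h wp) ->
    measurable_fun setT (fun w => fine (\int[nu]_p (h (w, p))%:E)%E).
  move=> mh h0; apply: (@measurableT_comp _ _ _ _ _ _ fine) => //.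
  apply: (@measurable_fun_fubini_tonelli_F _ _ _ _ _ nu (EFin \o h)) => //.
  exact/measurable_EFinP.
apply: measurable_funM.
  apply: (mfubini (fun wp => shrink k wp.2 * weight (Y wp.1) wp.2)).
    apply: measurable_funM; last exact: measurable_weight.
    by apply: (measurableT_comp (measurable_shrink k)); exact: measurable_snd.
  by move=> wp; rewrite mulr_ge0.
apply: (measurableT_comp (measurable_invr R)).
apply: (mfubini (fun wp => weight (Y wp.1) wp.2)) => [|wp].
  exact: measurable_weight.
exact: weight_ge0.
Qed.

Let shrink_bounds k p : ~ N p -> eta0 / (eta0 + sbar) <= shrink k p <= 1.
Proof.
move=> /NP[gp /andP[p0 ps]]; rewrite /shrink.
have g0 : 0 < gam p.1 k by apply: lt_le_trans eta0_gt0 _.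
have gp0 : 0 < gam p.1 k + p.2 by rewrite addr_gt0.
rewrite ger0_norm ?divr_ge0 ?(ltW g0) ?(ltW gp0)//; apply/andP; split.
  rewrite ler_pdivrMr ?addr_gt0// mulrAC ler_pdivlMr//.
  by have := gp k; nra.
by rewrite ler_pdivrMr// mul1r lerDl ltW.
Qed.

(** The bound of [evidence_le] does not depend on (gamma, sigma^2), so off [N] the weight is bounded
    by a constant, which a probability integrates. *)
Lemma integrable_weight y : 0 < residual X y ->
  nu.-integrable setT (EFin \o weight y).
Proof.
move=> y0; apply/integrableP; split; first exact/measurable_EFinP.
pose B := (Num.min 1 (residual X y / (2 * n%:R ^+ 2)))^-1 ^+ n.
have B0 : 0 <= B.
  rewrite exprn_ge0// invr_ge0 le_min ler01/=.
  apply: divr_ge0; first exact: ltW.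
  by rewrite mulr_ge0// exprn_ge0.
apply: (@le_lt_trans _ _ (\int[nu]_p (cst B%:E p))%E); last first.
  by rewrite integral_cst// [X in (_ * X)%E]nuT mule1 ltry.
apply: ae_ge0_le_integral => //.
  by apply: measurableT_comp => //; exact/measurable_EFinP.
exists N; split => // p /=; apply: contra_notP => /NP[gp /andP[p0 _]] _.
rewrite lee_fin ger0_norm ?weight_ge0// /B /residual.
apply: evidence_le => // k; exact: lt_le_trans eta0_gt0 _.
Qed.

(** The pointwise bounds on [shrink] are integrated against [weight] and divided by the normalising
    integral, which is finite by the positive residual and nonzero because the evidence is positive
    off [N]. *)
Lemma shrink_mean_bounds y k : 0 < residual X y ->
  eta0 / (eta0 + sbar) <= shrink_mean y k <= 1.
Proof.
move=> y0; have iw := integrable_weight _ y0.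
have ew0 p : (0 <= (weight y p)%:E)%E by rewrite lee_fin weight_ge0.
have esw0 p : (0 <= (shrink k p * weight y p)%:E)%E.
  by rewrite lee_fin mulr_ge0.
have c0 : 0 <= eta0 / (eta0 + sbar).
  by rewrite divr_ge0 ?addr_ge0 ?(ltW eta0_gt0) ?(ltW sbar_gt0).
have Dfin := integrable_fin_num measurableT iw.
have D0 : (0 < \int[nu]_p (weight y p)%:E)%E.
  apply: (@integral_gt0 _ _ _ _ N) => //.
  - by rewrite [X in X != _]nuT onee_neq0.
  - exact/measurable_EFinP.
  - move=> p /NP[gp /andP[p0 _]]; rewrite lte_fin; apply: evidence_gt0 => // j.
    exact: lt_le_trans eta0_gt0 _.
have upper : (\int[nu]_p (shrink k p * weight y p)%:E
    <= \int[nu]_p (weight y p)%:E)%E.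
  apply: ae_ge0_le_integral => //; try exact/measurable_EFinP.
  exists N; split => // p /=; apply: contra_notP => Np _.
  have /andP[_ s1] := shrink_bounds k _ Np.
  by rewrite lee_fin ler_piMl// weight_ge0.
have lower : ((eta0 / (eta0 + sbar))%:E * \int[nu]_p (weight y p)%:E
    <= \int[nu]_p (shrink k p * weight y p)%:E)%E.
  rewrite -ge0_integralZl//; last exact/measurable_EFinP.
  apply: ae_ge0_le_integral => //.
  - by move=> p _; rewrite mule_ge0.
  - apply: emeasurable_funM => //; exact/measurable_EFinP.
  - exact/measurable_EFinP.
  exists N; split => // p /=; apply: contra_notP => Np _.
  have /andP[s1 _] := shrink_bounds k _ Np.
  by rewrite -EFinM lee_fin ler_wpM2r// weight_ge0.
have Nfin : (\int[nu]_p (shrink k p * weight y p)%:E)%E \is a fin_num.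
  rewrite ge0_fin_numE ?integral_ge0//; apply: le_lt_trans upper _.
  by rewrite -ge0_fin_numE ?integral_ge0.
have D0' : 0 < fine (\int[nu]_p (weight y p)%:E)%E.
  by rewrite fine_gt0// D0/= ltey_eq Dfin.
rewrite /shrink_mean ler_pdivlMr// ler_pdivrMr// mul1r.
by rewrite -!lee_fin EFinM !fineK// lower upper.
Qed.

(** A positive residual gives the integrability that Fubini needs for the signed numerator. The
    other alternative serves the samples with sigma-hat = 0: both numerators are then 0, whatever
    the denominators. *)
Lemma post_meanE y k : 0 < residual X y \/ coef X y k = 0 ->
  post_mean X n%:R piG gam mu y k = coef X y k * shrink_mean y k.
Proof.
move=> yk; rewrite /post_mean /shrink_mean mulrA; congr (_ / fine _); last first.
  rewrite fubini_tonelli1//; last 2 first.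
    exact/measurable_EFinP.
    by move=> p; rewrite lee_fin weight_ge0.
  (* The closed form of the integral over beta is available only on the support of the prior, so the
     integrands are exchanged off null sets. *)
  apply: (eq_integral_null _ N1) => // t N1t.
  apply: (eq_integral_null _ N2) => // s N2s.
  rewrite intRK_evidence//; last by move=> j; exact: gam_gt0.
  by have /andP[] := sN2 _ N2s.
transitivity (fine (\int[piG]_t \int[mu]_s
    (coef X y k * (shrink k (t, s) * weight y (t, s)))%:E)%E).
  congr fine.
  apply: (eq_integral_null _ N1) => // t N1t.
  apply: (eq_integral_null _ N2) => // s N2s.
  have /andP[s0 _] := sN2 _ N2s.
  rewrite intRK_posterior_mean//; last by move=> j; exact: gam_gt0.
  rewrite -mulrA; congr (_ * (_ * _))%:E.
  have g0 := gam_gt0 _ k N1t.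
  by rewrite /shrink/= ger0_norm// divr_ge0 ?addr_ge0 ?(ltW g0) ?(ltW s0).
case: yk => [y0|->]; last first.
  under eq_integral do under eq_integral do rewrite mul0r.
  under eq_integral do rewrite integral0.
  by rewrite integral0 mul0r.
have isw : nu.-integrable setT (fun p => (shrink k p * weight y p)%:E).
  apply/(negligible_integrable mN measurableT _ N0).
    exact/measurable_EFinP.
  apply: (@le_integrable _ _ _ nu _ _ _ (EFin \o weight y)).
  - exact: measurableD.
  - by apply: measurable_funTS; exact/measurable_EFinP.
  - move=> p [_ Np]; rewrite lee_fin normrM.
    have /andP[_ s1] := shrink_bounds k _ Np.
    by rewrite ler_piMl// /shrink normr_id.
  - apply: (integrableS measurableT) => //; first exact: measurableD.
    exact: integrable_weight.
rewrite (integral12_prod_meas1 (f := fun p =>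
  (coef X y k * (shrink k p * weight y p))%:E)).
  under eq_integral do rewrite EFinM.
  rewrite integralZl// fineM//; exact: integrable_fin_num.
under eq_fun do rewrite EFinM.
exact: integrableZl.
Qed.

End posterior_mean.

Arguments shrink_mean {R dG TG} piG mu {K} gam {n} X y k.

(** * Selection on the good event *)

Section regression.
Context {R : realType}.
Variables (n K : nat) (X : 'M[R]_(n, K)).
Hypotheses (n_gt0 : (0 < n)%N) (XX : X^T *m X = n%:R%:M).

Let nN0 : n%:R != 0 :> R. Proof. by rewrite pnatr_eq0 -lt0n. Qed.

Lemma residualE (y : 'cV[R]_n) : residual X y =
  \sum_(i < n) (y i ord0 - \sum_(k < K) X i k * coef X y k) ^+ 2.
Proof.
rewrite sum_sqr_residual// /residual.
have -> : \sum_(k < K) coef X y k * coef X y k = \sum_(k < K) coef X y k ^+ 2.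
  by apply: eq_bigr => k _; rewrite expr2.
by ring.
Qed.

Lemma residual_ge0 (y : 'cV[R]_n) : 0 <= residual X y.
Proof. by rewrite residualE sumr_ge0// => i _; exact: sqr_ge0. Qed.

Lemma coefZ (c : R) (y : 'cV[R]_n) k : coef X (c *: y) k = c * coef X y k.
Proof.
rewrite /coef mulrA; congr (_ / _); rewrite mulr_sumr.
by apply: eq_bigr => i _; rewrite mxE mulrCA.
Qed.

Lemma residualZ (c : R) (y : 'cV[R]_n) :
  residual X (c *: y) = c ^+ 2 * residual X y.
Proof.
rewrite /residual mulrBr; congr (_ - _).
  by rewrite /sqnorm mulr_sumr; apply: eq_bigr => i _; rewrite mxE exprMn.
rewrite mulrCA; congr (_ * _); rewrite mulr_sumr.
by apply: eq_bigr => k _; rewrite coefZ exprMn.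
Qed.

Lemma olsE (Y : 'cV[R]_n) k : ols X Y k ord0 = coef X Y k.
Proof.
rewrite /ols XX invmx_scalar mul_scalar_mx -scalemxAl !mxE mulrC /coef.
by congr (_ / _); apply: eq_bigr => i _; rewrite mxE.
Qed.

Lemma sigma2hatE (Y : 'cV[R]_n) : sigma2hat X Y = residual X Y / (n - K)%:R.
Proof.
rewrite /sigma2hat residualE; congr (_ / _); apply: eq_bigr => i _.
rewrite !mxE; congr ((_ - _) ^+ 2).
by apply: eq_bigr => k _; rewrite olsE.
Qed.

Lemma coef_resp (beta0 : 'cV[R]_K) (e : nat -> R) k :
  coef X (resp X beta0 e) k =
  beta0 k ord0 + coef X (\col_(i < n) e (val i)) k.
Proof.
have XXE : \sum_(i < n) X i k * (X *m beta0) i ord0 = n%:R * beta0 k ord0.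
  transitivity ((X^T *m (X *m beta0)) k ord0).
    by rewrite [RHS]mxE; apply: eq_bigr => i _; rewrite [in RHS]mxE.
  by rewrite mulmxA XX mul_scalar_mx mxE.
rewrite /coef.
under eq_bigr do rewrite mxE mulrDr.
by rewrite big_split/= XXE mulrDl mulrC mulKf.
Qed.

(** The mean X beta0 lies in the column space of X and is reproduced exactly by the fit, so only the
    noise leaves a residual. *)
Lemma residual_resp (beta0 : 'cV[R]_K) (e : nat -> R) :
  residual X (resp X beta0 e) = residual X (\col_(i < n) e (val i)).
Proof.
rewrite !residualE; apply: eq_bigr => i _; congr (_ ^+ 2).
under eq_bigr do rewrite coef_resp mulrDr.
rewrite big_split/= opprD addrA; congr (_ - _).
by rewrite [resp _ _ _ _ _]mxE [(X *m _) _ _]mxE addrAC subrr add0r.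
Qed.

End regression.

(** * Deterministic correctness of the selection *)

Section selection.
Context {R : realType}.
Variables (n K : nat) (X : 'M[R]_(n, K)).
Hypotheses (K_lt_n : (K < n)%N) (K2_le_n : (K * 2 <= n)%N).
Hypothesis XX : X^T *m X = n%:R%:M.
Variables (beta0 : 'cV[R]_K) (e : nat -> R) (sigma0 C c : R).
Hypotheses (sigma0_gt0 : 0 < sigma0) (C_gt0 : 0 < C) (c_gt0 : 0 < c).

Let Y := resp X beta0 e.
Let E := \col_(i < n) e (val i).

Hypothesis ssq_close :
  `|\sum_(i < n) (e i ^+ 2 - sigma0 ^+ 2)| < n%:R * sigma0 ^+ 2 / 4.
Hypothesis score_small : forall k,
  `|\sum_(i < n) X i k * e i| < Num.sqrt n%:R * (sigma0 * C / 2).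
Hypothesis C_small : K%:R * C ^+ 2 <= n%:R.

Let n_gt0 : (0 < n)%N. Proof. exact: leq_ltn_trans K_lt_n. Qed.
Let nR_gt0 : 0 < n%:R :> R. Proof. by rewrite ltr0n. Qed.
Let rt_gt0 : 0 < Num.sqrt n%:R :> R. Proof. by rewrite sqrtr_gt0. Qed.
Let rt2 : Num.sqrt n%:R ^+ 2 = n%:R :> R.
Proof. by rewrite sqr_sqrtr// ltW. Qed.

Lemma coef_noise_lt k : `|coef X E k| < sigma0 * C / (2 * Num.sqrt n%:R).
Proof.
rewrite /coef normrM normfV (ger0_norm (ltW nR_gt0)) ltr_pdivrMr//.
rewrite (_ : _ * n%:R = Num.sqrt n%:R * (sigma0 * C / 2)).
  by under eq_bigr do rewrite mxE.
by rewrite -[X in _ * X = _]rt2; field; rewrite gt_eqF.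
Qed.

(** The residual is |eps|^2 - D. The first term is within n sigma0^2 / 4 of n sigma0^2, and the
    score bounds with K C^2 <= n give 0 <= D <= n sigma0^2 / 4; hence it lies between n sigma0^2 / 2
    and 5 n sigma0^2 / 4, while n / 2 <= n - K <= n. The constant 4, rather than 5/2, makes the
    bound on sigma-hat a plain 2 sigma0. *)
Lemma sigma2hat_bounds :
  sigma0 ^+ 2 / 2 <= sigma2hat X Y <= 4 * sigma0 ^+ 2.
Proof.
have nK_gt0 : 0 < (n - K)%:R :> R by rewrite ltr0n subn_gt0.
have nKE : (n - K)%:R = n%:R - K%:R :> R by rewrite natrB// ltnW.
have K0 : 0 <= K%:R :> R by [].
have K2 : 2 * K%:R <= n%:R :> R by rewrite -natrM ler_nat mulnC.
have s2 : 0 < sigma0 ^+ 2 by rewrite exprn_gt0.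
rewrite sigma2hatE// residual_resp// -/E /residual.
have -> : sqnorm E = \sum_(i < n) (e i ^+ 2 - sigma0 ^+ 2) + n%:R * sigma0 ^+ 2.
  rewrite sumrB sumr_const card_ord -[sigma0 ^+ 2 *+ n]mulr_natl subrK.
  by apply: eq_bigr => i _; rewrite mxE.
set S := \sum_(i < n) _; set D := n%:R * \sum_(k < K) _.
have /andP[S1 S2] : - (n%:R * sigma0 ^+ 2 / 4) < S < n%:R * sigma0 ^+ 2 / 4.
  by rewrite -ltr_norml.
have D0 : 0 <= D by rewrite mulr_ge0// sumr_ge0// => k _; exact: sqr_ge0.
have D1 : D <= n%:R * sigma0 ^+ 2 / 4.
  rewrite /D.
  have : \sum_(k < K) coef X E k ^+ 2 <=
      \sum_(k < K) (sigma0 * C / (2 * Num.sqrt n%:R)) ^+ 2.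
    apply: ler_sum => k _; rewrite -(real_normK (num_real (coef X E k))).
    rewrite lerXn2r ?nnegrE//; last exact/ltW/coef_noise_lt.
    by rewrite divr_ge0 ?mulr_ge0 ?ltW.
  rewrite sumr_const card_ord -[X in _ <= X]mulr_natl => h.
  apply: (le_trans (ler_wpM2l (ltW nR_gt0) h)).
  rewrite [leLHS](_ : _ = (K%:R * C ^+ 2) * (sigma0 ^+ 2 / 4)); last first.
    rewrite (_ : (_ / _) ^+ 2 = sigma0 ^+ 2 * C ^+ 2 / (4 * n%:R)).
      by field; rewrite gt_eqF.
    by rewrite -[X in _ / (4 * X)]rt2; field; rewrite gt_eqF.
  by rewrite -[leRHS]mulrA ler_wpM2r// divr_ge0// ltW.
apply/andP; split; rewrite ?ler_pdivlMr ?ler_pdivrMr// nKE; nra.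
Qed.

(** For a zero coefficient, sigma-hat > sigma0 / 2 turns the score bound sigma0 C / 2 into |z_k| <
    C, and rho_k <= 1 preserves it. For a nonzero b, the penultimate hypothesis keeps the noise
    below |b| / 2, and the last one says that C is at most sqrt n (2 sigma0)^-1 (|b| / 2) c, a lower
    bound for the selected quantity. *)
Lemma selection_correct (bstar rho : 'I_K -> R) :
  (forall k, bstar k = (Num.sqrt (sigma2hat X Y))^-1 * Num.sqrt n%:R
     * coef X Y k * rho k) ->
  (forall k, c <= rho k <= 1) ->
  (forall k, beta0 k ord0 != 0 ->
     sigma0 * C / Num.sqrt n%:R <= `|beta0 k ord0|) ->
  (forall k, beta0 k ord0 != 0 ->
     C / Num.sqrt n%:R <= c * `|beta0 k ord0| / (4 * sigma0)) ->
  Mn bstar C = M0 beta0.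
Proof.
move=> bstarE rho_c hb1 hb2; have /andP[sg1 sg2] := sigma2hat_bounds.
set sg := Num.sqrt (sigma2hat X Y) in bstarE *.
have s2_gt0 : 0 < sigma2hat X Y.
  by apply: lt_le_trans sg1; rewrite divr_gt0// exprn_gt0.
have sg_gt0 : 0 < sg by rewrite sqrtr_gt0.
have sgE : sg ^+ 2 = sigma2hat X Y by rewrite sqr_sqrtr// ltW.
have sigma2_gt0 : 0 < sigma0 ^+ 2 by rewrite exprn_gt0.
have sg_lo : sigma0 / 2 < sg.
  rewrite -(@ltr_pXn2r _ 2) ?nnegrE ?divr_ge0 ?(ltW sg_gt0) ?(ltW sigma0_gt0)//.
  by rewrite sgE expr_div_n; lra.
have sg_hi : sg <= 2 * sigma0.
  rewrite -(@ler_pXn2r _ 2) ?nnegrE ?mulr_ge0 ?(ltW sg_gt0) ?(ltW sigma0_gt0)//.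
  by rewrite sgE exprMn; lra.
apply/funext => k; rewrite /Mn /M0 bstarE coef_resp// -/E.
have dk := coef_noise_lt k; set dl := coef X E k in dk *.
set r := Num.sqrt n%:R in dk *.
have r0 : 0 < r by exact: rt_gt0.
have /andP[rc r1] := rho_c k; have rho0 : 0 < rho k by apply: lt_le_trans rc.
rewrite !normrM (ger0_norm (ltW rho0)) normfV (gtr0_norm sg_gt0) (gtr0_norm r0).
have dk' : `|dl| * r < sigma0 * C / 2.
  rewrite -ltr_pdivlMr//; apply: (lt_le_trans dk).
  by rewrite le_eqVlt; apply/orP; left; apply/eqP; field; rewrite gt_eqF.
have [b0|b0] := eqVneq (beta0 k ord0) 0.
  rewrite b0 add0r; apply/negbTE; rewrite -ltNge.
  apply: (@le_lt_trans _ _ (sg^-1 * r * `|dl|)).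
    by rewrite ler_piMr// !mulr_ge0 ?invr_ge0 ?(ltW sg_gt0) ?(ltW r0).
  rewrite -mulrA mulrC ltr_pdivrMr// mulrC; apply: (lt_trans dk').
  by rewrite (_ : _ / 2 = C * (sigma0 / 2)) ?ltr_pM2l//; ring.
have hb1' := hb1 k b0; have hb2' := hb2 k b0.
set b := beta0 k ord0 in b0 hb1' hb2' *.
have b_gt0 : 0 < `|b| by rewrite normr_gt0.
have bd : `|b| / 2 <= `|b + dl|.
  have := lerB_normD b dl.
  have : `|dl| <= `|b| / 2.
    apply/ltW/(lt_le_trans dk).
    rewrite (_ : _ / _ = (sigma0 * C / r) / 2); first by rewrite ler_pM2r.
    by field; rewrite gt_eqF.
  by lra.
rewrite ler_pdivrMr// in hb2'.
apply: (le_trans hb2').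
have sgV : (2 * sigma0)^-1 <= sg^-1 by rewrite lef_pV2// posrE mulr_gt0.
rewrite (_ : c * `|b| / (4 * sigma0) * r = (2 * sigma0)^-1 * r * (`|b| / 2) * c).
  by rewrite !ler_pM ?mulr_ge0 ?invr_ge0 ?(ltW r0) ?(ltW c_gt0)//
    ?mulr_ge0 ?(ltW sigma0_gt0).
by field; rewrite gt_eqF.
Qed.

End selection.

(** * Tail bounds for the noise *)

Section independence.
Context {R : realType} {d : measure_display} {T : measurableType d}.
Variables (P : probability T R).

(** Independence identifies the joint law with the product of the marginal laws, by uniqueness on
    rectangles. Fubini then integrates [f] first, at each fixed value of the second variable, and
    that inner integral is 0. *)
Lemma integral_prod_indep0 (X Y : T -> R) (f g : R -> R) :
  measurable_fun setT X -> measurable_fun setT Y ->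
  measurable_fun setT f -> measurable_fun setT g ->
  (forall A B : set R, measurable A -> measurable B ->
    P (X @^-1` A `&` Y @^-1` B) = P (X @^-1` A) * P (Y @^-1` B))%E ->
  P.-integrable setT (fun w => (f (X w))%:E) ->
  P.-integrable setT (fun w => (f (X w) * g (Y w))%:E) ->
  (\int[P]_w (f (X w))%:E = 0)%E ->
  (\int[P]_w (f (X w) * g (Y w))%:E = 0)%E.
Proof.
move=> mX mY mf mg indXY iX iXY f0.
pose X' : {mfun T >-> R} := HB.pack X (isMeasurableFun.Build _ _ _ _ X mX).
pose Y' : {mfun T >-> R} := HB.pack Y (isMeasurableFun.Build _ _ _ _ Y mY).
pose mu1 : probability R R := distribution P X'.
pose mu2 : probability R R := distribution P Y'.
pose Z w := (X w, Y w).
pose h (p : R * R) : \bar R := (f p.1 * g p.2)%:E.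
have mh : measurable_fun setT h.
  apply/measurable_EFinP/measurable_funM.
    exact: (measurableT_comp mf measurable_fst).
  exact: (measurableT_comp mg measurable_snd).
have mZ : measurable_fun setT Z by exact: measurable_fun_pair.
have lawE A : measurable A -> (mu1 \x mu2)%E A = pushforward P Z A.
  by move=> mA; exact: product_measure_unique.
have ihZ : (mu1 \x mu2)%E.-integrable setT h.
  apply/integrableP; split => //.
  have /integrableP[_] := integrable_pushforward mZ mh iXY measurableT.
  rewrite (eq_measure_integral (mu1 \x mu2)%E)// => A mA _.
  exact/esym/lawE.
transitivity (\int[(mu1 \x mu2)%E]_p h p)%E.
  rewrite (eq_measure_integral (pushforward P Z)); last first.
    by move=> A mA _; exact: lawE.
  by rewrite (integral_pushforward mZ mh iXY).
rewrite -integral21_prod_meas1//.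
have if1 : mu1.-integrable setT (EFin \o f).
  apply: (integrable_pushforward mX) => //; exact/measurable_EFinP.
have f10 : (\int[mu1]_x (f x)%:E = 0)%E.
  rewrite -f0; apply: (integral_pushforward mX _ iX) => //.
  exact/measurable_EFinP.
rewrite /fubini_G /h/=.
under eq_integral => y _.
  under eq_integral do rewrite EFinM.
  rewrite integralZr// f10 mul0e.
  over.
by rewrite integral0.
Qed.

End independence.

Section chebyshev_uncorrelated.
Context {R : realType} {d : measure_display} {T : measurableType d}.
Variables (P : probability T R).

Lemma integrable_mul_sqr (u v : T -> R) :
  measurable_fun setT u -> measurable_fun setT v ->
  P.-integrable setT (fun w => (u w ^+ 2)%:E) ->
  P.-integrable setT (fun w => (v w ^+ 2)%:E) ->
  P.-integrable setT (fun w => (u w * v w)%:E).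
Proof.
move=> mu mv iu iv.
apply: (@le_integrable _ _ _ P setT _ _
  (fun w => (u w ^+ 2)%:E + (v w ^+ 2)%:E)%E) => //.
- by apply/measurable_EFinP; exact: measurable_funM.
- move=> w _; rewrite -EFinD !abse_EFin lee_fin normrM.
  rewrite -(real_normK (num_real (u w))) -(real_normK (num_real (v w))).
  set x := `|u w|; set y := `|v w|.
  apply: le_trans (ler_norm _).
  have := sqr_ge0 (x - y); have := sqr_ge0 x; have := sqr_ge0 y; nra.
- exact: integrableD.
Qed.

Variables (n : nat) (Z : 'I_n -> T -> R) (V : R).
Hypothesis mZ : forall i, measurable_fun setT (Z i).
Hypothesis iZ : forall i, P.-integrable setT (fun w => (Z i w ^+ 2)%:E).
Hypothesis ZV : forall i, (\int[P]_w (Z i w ^+ 2)%:E <= V%:E)%E.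
Hypothesis Z0 : forall i j, i != j -> (\int[P]_w (Z i w * Z j w)%:E = 0)%E.

Let iZZ i j : P.-integrable setT (fun w => (Z i w * Z j w)%:E).
Proof. exact: integrable_mul_sqr. Qed.

(** Expanding the square leaves only the diagonal terms, the cross moments being 0. *)
Lemma second_moment_weighted_sum (a : 'I_n -> R) :
  (\int[P]_w ((\sum_(i < n) a i * Z i w) ^+ 2)%:E
   <= (V * \sum_(i < n) a i ^+ 2)%:E)%E.
Proof.
have iaZZ i j : P.-integrable setT
    (fun w => (a i * a j)%:E * (Z i w * Z j w)%:E)%E by exact: integrableZl.
have -> : (\int[P]_w ((\sum_(i < n) a i * Z i w) ^+ 2)%:E =
    \sum_(i < n) \sum_(j < n) \int[P]_w ((a i * a j)%:E * (Z i w * Z j w)%:E))%E.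
  under [RHS]eq_bigr => i _ do rewrite -integral_sum//.
  rewrite -integral_sum//; last first.
    by move=> i; apply: integrable_sum => // j _; exact: iaZZ.
  apply: eq_integral => w _; rewrite expr2 big_distrlr/= -sumEFin.
  apply: eq_bigr => i _; rewrite -sumEFin; apply: eq_bigr => j _.
  by rewrite -EFinM; congr EFin; ring.
rewrite mulr_sumr -sumEFin; apply: lee_sum => i _.
rewrite (bigD1 i)//= big1 ?adde0; last first.
  by move=> j ji; rewrite integralZl// Z0 ?mule0// eq_sym.
rewrite integralZl// -[(a i * a i)%R]expr2 [V * _]mulrC [(_ * V)%:E]EFinM; apply: lee_wpmul2l.
  by rewrite lee_fin sqr_ge0.
by under eq_integral do rewrite -expr2.
Qed.

Lemma chebyshev_weighted_sum (a : 'I_n -> R) (t : R) : 0 < t ->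
  (P [set w | t <= `|\sum_(i < n) a i * Z i w|]%R
   <= (V * (\sum_(i < n) a i ^+ 2) / t ^+ 2)%:E)%E.
Proof.
move=> t0; have t20 : 0 < t ^+ 2 by rewrite exprn_gt0.
have mS : measurable_fun setT (fun w => \sum_(i < n) a i * Z i w).
  by apply: measurable_sum => i; exact: measurable_funM.
have := le_integral_abse P measurableT (a := t ^+ 2)
  (g := fun w => ((\sum_(i < n) a i * Z i w) ^+ 2)%:E).
rewrite setTI => /(_ _ t20) h.
rewrite EFinM lee_pdivlMr// muleC.
apply: le_trans (second_moment_weighted_sum a).
rewrite [leRHS](_ : _ =
    \int[P]_w `|((\sum_(i < n) a i * Z i w) ^+ 2)%:E|)%E; last first.
  by apply: eq_integral => w _; rewrite abse_EFin ger0_norm ?sqr_ge0.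
rewrite [X in P X](_ : _ =
  [set w | ((t ^+ 2)%:E <= `|((\sum_(i < n) a i * Z i w) ^+ 2)%:E|)%E]).
  by apply: h; apply/measurable_EFinP; exact: measurable_funX.
by apply/seteqP; split => w /=;
  rewrite lee_fin normrX ler_pXn2r ?nnegrE ?(ltW t0).
Qed.

End chebyshev_uncorrelated.

Section noise.
Context {R : realType} {d : measure_display} {T : measurableType d}.
Variables (P : probability T R) (eps : nat -> T -> R) (sigma0 M : R).
Hypothesis meps : forall i, measurable_fun setT (eps i).
Hypothesis indep : mutually_independent P eps.
Hypothesis ieps : forall i, P.-integrable setT (EFin \o eps i).
Hypothesis eps_mean : forall i, ('E_P[eps i] = 0)%E.
Hypothesis eps_var : forall i, ('E_P[eps i ^+ 2] = (sigma0 ^+ 2)%:E)%E.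
Hypothesis eps_fourth : forall i, ('E_P[eps i ^+ 4] <= M%:E)%E.

Lemma pairwise_independent i j (A B : set R) : i != j ->
  measurable A -> measurable B ->
  P (eps i @^-1` A `&` eps j @^-1` B) = (P (eps i @^-1` A) * P (eps j @^-1` B))%E.
Proof.
move=> ij mA mB.
have := indep [:: i; j] (fun k => if k == i then A else B).
rewrite /= inE ij !big_cons big_nil eqxx eq_sym (negbTE ij) mule1.
move=> <- //; last by move=> k; case: ifP.
congr (P _); apply/seteqP; split => w /=.
  move=> [Aw Bw] k /=; rewrite !inE => /orP[|] /eqP ->; first by rewrite eqxx.
  by rewrite eq_sym (negbTE ij).
move=> h; split; first by have := h i; rewrite /= !inE eqxx; exact.
by have := h j; rewrite /= !inE eqxx orbT eq_sym (negbTE ij); exact.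
Qed.

Let eps2E i : (\int[P]_w (eps i w ^+ 2)%:E = (sigma0 ^+ 2)%:E)%E.
Proof. by rewrite -(eps_var i) unlock exprfctE. Qed.

Let ieps2 i : P.-integrable setT (fun w => (eps i w ^+ 2)%:E).
Proof.
apply/integrableP; split; first by apply/measurable_EFinP; exact: measurable_funX.
under eq_integral do rewrite abse_EFin ger0_norm ?sqr_ge0//.
by rewrite eps2E ltry.
Qed.

Let ieps4 i : P.-integrable setT (fun w => (eps i w ^+ 4)%:E).
Proof.
apply/integrableP; split; first by apply/measurable_EFinP; exact: measurable_funX.
under eq_integral do rewrite abse_EFin ger0_norm ?exprn_even_ge0//.
apply: le_lt_trans (ltry M); have := eps_fourth i.
by rewrite unlock exprfctE.
Qed.

Let sq i w := eps i w ^+ 2 - sigma0 ^+ 2.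

Let msq i : measurable_fun setT (sq i).
Proof. by apply: measurable_funB => //; exact: measurable_funX. Qed.

(** In (x - y)^2 with x, y >= 0 the cross term is at most 0. This is where the fourth moment enters
    and where the constant M + sigma0^4 comes from. *)
Let sq2_le i w : sq i w ^+ 2 <= eps i w ^+ 4 + sigma0 ^+ 4.
Proof.
rewrite /sq -[4%N]/(2 * 2)%N !exprM.
have := sqr_ge0 (eps i w); have := sqr_ge0 sigma0; nra.
Qed.

Let integral_EFin_cst (c : R) : (\int[P]_w c%:E = c%:E)%E.
Proof.
apply: etrans (integral_cst P measurableT c%:E) _.
by rewrite [X in (_ * X)%E]probability_setT mule1.
Qed.

Let ibound i : P.-integrable setT
  (fun w => (eps i w ^+ 4)%:E + (cst (sigma0 ^+ 4) w)%:E)%E.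
Proof.
apply: integrableD => //; exact: finite_measure_integrable_cst.
Qed.

Let isq2 i : P.-integrable setT (fun w => (sq i w ^+ 2)%:E).
Proof.
apply: le_integrable (ibound i) => //.
  by apply/measurable_EFinP; exact: measurable_funX.
move=> w _; rewrite -EFinD !abse_EFin lee_fin ger0_norm ?sqr_ge0//.
by apply: le_trans (ler_norm _); exact: sq2_le.
Qed.

Let sq2_moment i : (\int[P]_w (sq i w ^+ 2)%:E <= (M + sigma0 ^+ 4)%:E)%E.
Proof.
apply: (@le_trans _ _ (\int[P]_w ((eps i w ^+ 4)%:E + (cst (sigma0 ^+ 4) w)%:E))%E).
  apply: ge0_le_integral => //.
  - by move=> w _; rewrite lee_fin sqr_ge0.
  - by apply/measurable_EFinP; exact: measurable_funX.
  - by have /integrableP[] := ibound i.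
  - by move=> w _; rewrite -EFinD lee_fin sq2_le.
rewrite integralD//; last exact: finite_measure_integrable_cst.
rewrite EFinD; apply: leeD.
  by have := eps_fourth i; rewrite unlock exprfctE.
by rewrite [leLHS]integral_EFin_cst.
Qed.

Lemma score_tail n (a : 'I_n -> R) (t : R) : 0 < t ->
  (P [set w | t <= `|\sum_(i < n) a i * eps i w|]%R
   <= (sigma0 ^+ 2 * (\sum_(i < n) a i ^+ 2) / t ^+ 2)%:E)%E.
Proof.
apply: (chebyshev_weighted_sum P n (fun i => eps i)) => //.
  by move=> i; rewrite eps2E.
move=> i j ij; apply: (integral_prod_indep0 P _ _ id id) => //.
- by move=> A B mA mB; exact: pairwise_independent.
- exact: ieps.
- exact: integrable_mul_sqr.
- by have := eps_mean i; rewrite unlock.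
Qed.

(** The centred squares inherit pairwise independence and have mean 0, so they are uncorrelated as
    well. *)
Lemma sum_sqr_tail n (t : R) : 0 < t ->
  (P [set w | t <= `|\sum_(i < n) (eps i w ^+ 2 - sigma0 ^+ 2)|]%R
   <= ((M + sigma0 ^+ 4) * n%:R / t ^+ 2)%:E)%E.
Proof.
move=> t0.
have := chebyshev_weighted_sum P n (fun i => sq i) (M + sigma0 ^+ 4)
  _ _ _ _ (fun=> 1) t t0.
rewrite (_ : \sum_(i < n) 1 ^+ 2 = n%:R); last first.
  by rewrite (eq_bigr (fun=> 1)) ?sumr_const ?card_ord// => i _; rewrite expr1n.
rewrite (_ : (fun w => is_true (t <= `|\sum_(i < n) 1 * sq i w|)) =
  (fun w => t <= `|\sum_(i < n) sq i w|)); last first.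
  by apply/funext => w; under eq_bigr do rewrite mul1r.
apply => // i j ij.
apply: (integral_prod_indep0 P _ _ (fun x => x ^+ 2 - sigma0 ^+ 2)
  (fun x => x ^+ 2 - sigma0 ^+ 2)) => //.
- by apply: measurable_funB => //; exact: exprn_measurable.
- by apply: measurable_funB => //; exact: exprn_measurable.
- by move=> A B mA mB; exact: pairwise_independent.
- under eq_fun do rewrite EFinB.
  by apply: integrableB => //; exact: finite_measure_integrable_cst.
- exact: (integrable_mul_sqr P (sq i) (sq j)).
- under eq_integral do rewrite EFinB.
  rewrite integralB//; last exact: finite_measure_integrable_cst.
  by rewrite eps2E integral_EFin_cst subee.
Qed.

End noise.

(** * Measurability of the selected model *)

Section posterior_measurability.
Context {R : realType} {dG : measure_display} {TG : measurableType dG}.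
Variables (piG : probability TG R) (mu : probability R R).
Variables (K : nat) (gam : TG -> 'I_K -> R) (eta0 sbar : R).
Hypothesis mgam : forall k, measurable_fun setT (fun t => gam t k).
Hypothesis eta0_gt0 : 0 < eta0.
Hypothesis sbar_gt0 : 0 < sbar.
Hypothesis gam_eta0 : forall k : 'I_K, piG [set t | eta0 <= gam t k] = 1%E.
Hypothesis mu_sbar : mu [set s2 | s2 <= sbar] = 1%E.
Hypothesis mu_gt0 : mu [set s2 | 0 < s2] = 1%E.
Variables (n : nat) (X : 'M[R]_(n, K)).
Hypotheses (K_lt_n : (K < n)%N) (XX : X^T *m X = n%:R%:M).

Let n_gt0 : (0 < n)%N. Proof. exact: leq_ltn_trans K_lt_n. Qed.

(** There are finitely many coordinates, so their exceptional sets merge into one null set. *)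
Let prior_null : exists N1 : set TG, [/\ measurable N1, piG N1 = 0%E &
  forall t, ~ N1 t -> forall k, eta0 <= gam t k].
Proof.
have : {ae piG, forall t, forall k, eta0 <= gam t k}.
  apply: filter_forall => k; exists (~` [set t | eta0 <= gam t k]); split => //.
    apply: measurableC; rewrite -[X in measurable X]setTI.
    exact: measurable_fun_le.
  rewrite probability_setC ?gam_eta0 ?subee//.
  by rewrite -[X in measurable X]setTI; exact: measurable_fun_le.
move=> [N1 [mN1 N10 sN1]]; exists N1; split => // t N1t.
by apply: contrapT => h; apply/N1t/sN1.
Qed.

Let variance_null : exists N2 : set R, [/\ measurable N2, mu N2 = 0%E &
  forall s, ~ N2 s -> 0 < s <= sbar].
Proof.
have m1 : measurable [set s2 : R | s2 <= sbar].
  by rewrite -[X in measurable X]setTI; exact: measurable_fun_le.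
have m2 : measurable [set s2 : R | 0 < s2].
  rewrite (_ : mkset _ = ~` [set s2 : R | s2 <= 0]); last first.
    by apply/seteqP; split => s /=; rewrite ltNge => /negP.
  apply: measurableC; rewrite -[X in measurable X]setTI.
  exact: measurable_fun_le.
exists (~` [set s2 | s2 <= sbar] `|` ~` [set s2 | 0 < s2]); split.
- by apply: measurableU; exact: measurableC.
- apply: null_set_setU; try exact: measurableC.
    by rewrite [LHS]probability_setC// mu_sbar subee.
  by rewrite [LHS]probability_setC// mu_gt0 subee.
- by move=> s /not_orP[/contrapT sle /contrapT s0]; apply/andP.
Qed.

Lemma beta_starE (Y : 'cV[R]_n) k : beta_star X piG gam mu Y k =
  (Num.sqrt (sigma2hat X Y))^-1 * Num.sqrt n%:R * coef X Y k
  * shrink_mean piG mu gam X (rescaled X Y) k.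
Proof.
have [N1 [mN1 N10 hN1]] := prior_null.
have [N2 [mN2 N20 hN2]] := variance_null.
rewrite /beta_star (post_meanE piG mu K gam eta0 sbar mgam _ _ N1 N2)//.
  by rewrite coefZ.
(* If sigma-hat = 0, its inverse is 0 by convention, the rescaled data are 0 and so is the
   coefficient. Otherwise both the scale and the residual are positive. *)
have [s0|s0] := eqVneq (sigma2hat X Y) 0.
  by right; rewrite coefZ s0 sqrtr0 invr0 !mul0r.
left; rewrite residualZ mulr_gt0//.
  rewrite exprn_even_gt0//= mulf_neq0// ?invr_eq0 gt_eqF// sqrtr_gt0 ?ltr0n//.
  rewrite lt_neqAle eq_sym s0 sigma2hatE// divr_ge0//; exact: residual_ge0.
rewrite lt_neqAle residual_ge0// andbT eq_sym; apply: contra_neqN s0 => /eqP r0.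
by rewrite sigma2hatE// r0 mul0r.
Qed.

Lemma shrink_mean_rescaled_bounds (Y : 'cV[R]_n) k : 0 < sigma2hat X Y ->
  eta0 / (eta0 + sbar) <= shrink_mean piG mu gam X (rescaled X Y) k <= 1.
Proof.
move=> s0.
have [N1 [mN1 N10 hN1]] := prior_null.
have [N2 [mN2 N20 hN2]] := variance_null.
apply: (shrink_mean_bounds piG mu K gam eta0 sbar mgam _ _ N1 N2) => //.
rewrite residualZ mulr_gt0//.
  by rewrite exprn_gt0// mulr_gt0 ?invr_gt0 ?sqrtr_gt0 ?ltr0n.
have nK : 0 < (n - K)%:R :> R by rewrite ltr0n subn_gt0.
by move: s0; rewrite sigma2hatE// pmulr_lgt0// invr_gt0.
Qed.

(** Read off the factored form, which holds for every sample, instead of the iterated integrals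
    defining the posterior mean. *)
Lemma measurable_beta_star {d} {T : measurableType d} (beta0 : 'cV[R]_K)
    (eps : nat -> T -> R) k : (forall i, measurable_fun setT (eps i)) ->
  measurable_fun setT (fun w => beta_star X piG gam mu
    (resp X beta0 (fun i => eps i w)) k).
Proof.
move=> meps; pose Y w := resp X beta0 (fun i => eps i w).
have mY i : measurable_fun setT (fun w => Y w i ord0).
  rewrite (_ : (fun w => _) = (fun w => (X *m beta0) i ord0 + eps i w)).
    exact: measurable_funD.
  by apply/funext => w; rewrite /Y /resp mxE [in X in _ + X]mxE.
have mcoef j : measurable_fun setT (fun w => coef X (Y w) j).
  apply: measurable_funM => //; apply: measurable_sum => i.
  exact: measurable_funM.
have ms : measurable_fun setT
    (fun w => (Num.sqrt (sigma2hat X (Y w)))^-1 * Num.sqrt n%:R).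
  apply: measurable_funM => //.
  apply: (measurableT_comp (measurable_invr R)).
  apply: (measurableT_comp (measurable_sqrtr R)).
  under eq_fun do rewrite sigma2hatE//.
  apply: measurable_funM => //; apply: measurable_funB.
    by apply: measurable_sum => i; exact: measurable_funX.
  apply: measurable_funM => //; apply: measurable_sum => j.
  exact: measurable_funX.
under eq_fun do rewrite beta_starE.
apply: measurable_funM; first exact: measurable_funM.
apply: measurable_shrink_mean => // i.
under eq_fun do rewrite /rescaled mxE.
exact: measurable_funM.
Qed.

(* Needed because a measure is unconstrained on non-measurable sets. *)
Lemma measurable_Mn_neq {d} {T : measurableType d} (beta0 : 'cV[R]_K)
    (eps : nat -> T -> R) (C : R) : (forall i, measurable_fun setT (eps i)) ->
  measurable [set w | Mn (beta_star X piG gam mu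
    (resp X beta0 (fun i => eps i w))) C <> M0 beta0].
Proof.
move=> meps.
pose b w := beta_star X piG gam mu (resp X beta0 (fun i => eps i w)).
rewrite (_ : [set _ | _] = ~` \bigcap_(k in [set: 'I_K])
    ((fun w => C <= `|b w k|) @^-1` [set M0 beta0 k])).
  apply: measurableC; apply: fin_bigcap_measurable => // k _.
  rewrite -[X in measurable X]setTI.
  apply: measurable_fun_ler => //; apply: measurableT_comp => //.
  exact: measurable_beta_star.
apply/seteqP; split => w /=; apply: contra_not.
  by move=> h; apply/funext => k; exact: (h k I).
by move=> h k _ /=; rewrite -h.
Qed.

End posterior_measurability.

(** * Union bound and convergence in probability *)

Lemma measure_bigsetU_le {d} {T : measurableType d} {R : realType}
    (mu : {measure set T -> \bar R}) (I : finType) (B : I -> set T) :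
  (forall i, measurable (B i)) ->
  (mu (\big[setU/set0]_(i : I) B i) <= \sum_(i : I) mu (B i))%E.
Proof.
move=> mB; suff [_ //] : measurable (\big[setU/set0]_(i : I) B i) /\
  (mu (\big[setU/set0]_(i : I) B i) <= \sum_(i : I) mu (B i))%E.
apply: (big_ind2 (fun U s => measurable U /\ (mu U <= s)%E)) => //.
  by split => //; rewrite measure0.
move=> U s V t [mU Us] [mV Vt]; split; first exact: measurableU.
by apply: le_trans (measureU2 mu mU mV) _; exact: leeD.
Qed.

Theorem theorem7 (R : realType) (K : nat) (beta0 : 'cV[R]_K)
  (X : forall n : nat, 'M[R]_(n, K))
  (d : measure_display) (T : measurableType d) (P : probability T R)
  (eps : nat -> T -> R) (sigma0 M : R)
  (dG : measure_display) (TG : measurableType dG) (piG : probability TG R)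
  (gam : TG -> 'I_K -> R) (mu : probability R R) (eta0 s0 : R)
  (C : nat -> R) :
  (0 < K)%N ->
  (* design *)
  (forall n, (K < n)%N -> (X n)^T *m X n = n%:R%:M) ->
  (forall n, (K < n)%N -> forall k : 'I_K, \sum_(i < n) X n i k = 0) ->
  (fun n => (\big[Order.max/0]_(i < n) Num.sqrt (\sum_(k < K) X n i k ^+ 2))
             / Num.sqrt n%:R) @ \oo --> 0 ->
  (* errors *)
  (forall i, measurable_fun setT (eps i)) ->
  mutually_independent P eps ->
  (forall i, P.-integrable setT (EFin \o eps i)) ->
  (forall i, ('E_P[eps i] = 0)%E) ->
  0 < sigma0 ->
  (forall i, ('E_P[eps i ^+ 2] = (sigma0 ^+ 2)%:E)%E) ->
  (forall i, ('E_P[eps i ^+ 4] <= M%:E)%E) ->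
  (* priors *)
  (forall k, measurable_fun setT (fun t => gam t k)) ->
  0 < eta0 ->
  (forall k : 'I_K, piG [set t | eta0 <= gam t k] = 1%E) ->
  0 < s0 ^+ 2 ->
  mu [set s2 | s2 <= s0 ^+ 2] = 1%E ->
  mu [set s2 | 0 < s2] = 1%E ->
  (* thresholds *)
  (forall n, 0 < C n) ->
  {homo C : m n / (m <= n)%N >-> m <= n} ->
  C @ \oo --> +oo ->
  (fun n => C n / Num.sqrt n%:R) @ \oo --> 0 ->
  (* conclusion: Mhat_n -> M_0 in probability *)
  (fun n => P [set w | Mn (beta_star (X n) piG gam mu
                           (resp (X n) beta0 (fun i => eps i w))) (C n)
                       <> M0 beta0]) @ \oo --> 0%E.
Proof.
move=> K_gt0 XX _ _ meps indep ieps eps_mean sigma0_gt0 eps_var eps_fourth mgam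
  eta0_gt0 gam_eta0 sbar_gt0 mu_sbar mu_gt0 C_gt0 _ Coo Csmall.
pose c := eta0 / (eta0 + s0 ^+ 2).
have c_gt0 : 0 < c by rewrite divr_gt0// addr_gt0.
have sigma2_gt0 : 0 < sigma0 ^+ 2 by rewrite exprn_gt0.
(* Chebyshev at level n sigma0^2 / 4 for the centred squares gives the first term. At level sqrt n
   sigma0 C_n / 2, with sum_i x_ik^2 = n, each of the K scores gives 4 / C_n^2. *)
pose bound n : R := 16 * (M + sigma0 ^+ 4) / sigma0 ^+ 4 * n%:R^-1
  + K%:R * 4 * ((C n)^-1 * (C n)^-1).
have Csmall_lt e : 0 < e -> \forall n \near \oo, C n / Num.sqrt n%:R < e.
  by move=> e0; exact: (cvgr_lt _ Csmall).
apply: (@squeeze_cvge _ _ _ _ (cst 0%E) _ (fun n => (bound n)%:E)).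
- near=> n.
  have Kn : (K < n)%N by near: n; exact: nbhs_infty_gt.
  have K2n : (K * 2 <= n)%N by near: n; exact: nbhs_infty_ge.
  have n_gt0 : (0 < n)%N by exact: leq_ltn_trans Kn.
  have nR_gt0 : 0 < n%:R :> R by rewrite ltr0n.
  have rt_gt0 : 0 < Num.sqrt n%:R :> R by rewrite sqrtr_gt0.
  have rt2 : Num.sqrt n%:R ^+ 2 = n%:R :> R by rewrite sqr_sqrtr// ltW.
  have CK : C n / Num.sqrt n%:R < K%:R^-1.
    by near: n; apply: Csmall_lt; rewrite invr_gt0 ltr0n.
  have Cb1 : forall k, beta0 k ord0 != 0 ->
      sigma0 * C n / Num.sqrt n%:R <= `|beta0 k ord0|.
    near: n; apply: filter_forall => k.
    have [b0|b0] := eqVneq (beta0 k ord0) 0; first exact: nearW.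
    have e0 : 0 < `|beta0 k ord0| / sigma0 by rewrite divr_gt0 ?normr_gt0.
    apply: filterS (Csmall_lt _ e0) => n h _.
    by rewrite -mulrA mulrC -ler_pdivlMr// ltW.
  have Cb2 : forall k, beta0 k ord0 != 0 ->
      C n / Num.sqrt n%:R <= c * `|beta0 k ord0| / (4 * sigma0).
    near: n; apply: filter_forall => k.
    have [b0|b0] := eqVneq (beta0 k ord0) 0; first exact: nearW.
    have e0 : 0 < c * `|beta0 k ord0| / (4 * sigma0).
      by apply: divr_gt0; apply: mulr_gt0 => //; rewrite normr_gt0.
    by apply: filterS (Csmall_lt _ e0) => n h _; exact: ltW.
  have KC : K%:R * C n ^+ 2 <= n%:R.
    (* From u < 1 / K both K u and u are below 1, hence K u^2 <= 1. *)
    set u := C n / Num.sqrt n%:R in CK.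
    have u_ge0 : 0 <= u by rewrite divr_ge0// ltW.
    have K1 : 1 <= K%:R :> R by rewrite ler1n.
    have Ku : K%:R * u < 1 by rewrite mulrC -ltr_pdivlMr ?ltr0n// div1r.
    have -> : C n = u * Num.sqrt n%:R by rewrite divfK// gt_eqF.
    rewrite exprMn rt2 mulrA -[leRHS]mul1r ler_wpM2r// ?(ltW nR_gt0)//.
    by nra.
  rewrite measure_ge0/=.
  (* The bad events carry weak inequalities, as in Chebyshev's bound, so their complements supply
     the strict ones required for the selection. *)
  pose B0 := [set w | n%:R * sigma0 ^+ 2 / 4 <=
    `|\sum_(i < n) (eps i w ^+ 2 - sigma0 ^+ 2)|].
  pose B k := [set w | Num.sqrt n%:R * (sigma0 * C n / 2) <=
    `|\sum_(i < n) X n i k * eps i w|].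
  have mB0 : measurable B0.
    rewrite -[X in measurable X]setTI; apply: measurable_fun_le => //.
    apply: measurableT_comp => //; apply: measurable_sum => i.
    by apply: measurable_funB => //; exact: measurable_funX.
  have mB k : measurable (B k).
    rewrite -[X in measurable X]setTI; apply: measurable_fun_le => //.
    apply: measurableT_comp => //; apply: measurable_sum => i.
    exact: measurable_funM.
  have mUB : measurable (\big[setU/set0]_(k < K) B k).
    exact: bigsetU_measurable.
  apply: (@le_trans _ _ (P (B0 `|` \big[setU/set0]_(k < K) B k))).
    apply: le_measure; rewrite ?inE.
    + by apply: (measurable_Mn_neq _ _ _ _ eta0 (s0 ^+ 2)) => //; exact: XX.
    + exact: measurableU.
    + move=> w /=; apply: contra_notP => /not_orP[B0w Bw].
      have ssq : `|\sum_(i < n) (eps i w ^+ 2 - sigma0 ^+ 2)|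
          < n%:R * sigma0 ^+ 2 / 4 by rewrite ltNge; apply/negP.
      have score k : `|\sum_(i < n) X n i k * eps i w|
          < Num.sqrt n%:R * (sigma0 * C n / 2).
        rewrite ltNge; apply/negP => Bkw; apply: Bw.
        by rewrite -bigcup_seq; exists k => //=; rewrite mem_index_enum.
      have /andP[s_lo _] := sigma2hat_bounds n K (X n) Kn K2n (XX n Kn) beta0
        (fun i => eps i w) sigma0 (C n) sigma0_gt0 (C_gt0 n) ssq score KC.
      apply: (selection_correct n K (X n) Kn K2n (XX n Kn) beta0
        (fun i => eps i w) sigma0 (C n) c sigma0_gt0 (C_gt0 n) c_gt0 ssq score
        KC _ (shrink_mean piG mu gam (X n) (rescaled (X n)
          (resp (X n) beta0 (fun i => eps i w))))) => //.
        move=> k; apply: (beta_starE _ _ _ _ eta0 (s0 ^+ 2)) => //; exact: XX.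
      move=> k; apply: shrink_mean_rescaled_bounds => //; first exact: XX.
      by apply: lt_le_trans s_lo; rewrite divr_gt0.
  apply: (le_trans (measureU2 P mB0 mUB)).
  rewrite /bound EFinD; apply: leeD.
    apply: (le_trans (sum_sqr_tail P eps sigma0 M meps indep eps_var
      eps_fourth n _ _)).
      by rewrite divr_gt0// mulr_gt0.
    rewrite lee_fin le_eqVlt; apply/orP; left; apply/eqP; field.
    by rewrite !gt_eqF.
  apply: (le_trans (measure_bigsetU_le P _ _ mB)).
  apply: (@le_trans _ _ (\sum_(k < K) (4 * ((C n)^-1 * (C n)^-1))%:E)%E).
    apply: lee_sum => k _.
    apply: (le_trans (score_tail P eps sigma0 meps indep ieps eps_mean
      eps_var n (fun i => X n i k) _ _)).
      by rewrite mulr_gt0// divr_gt0// mulr_gt0.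
    rewrite lee_fin le_eqVlt; apply/orP; left; apply/eqP.
    have -> : \sum_(i < n) X n i k ^+ 2 = n%:R.
      have /matrixP/(_ k k) := XX n Kn; rewrite !mxE eqxx mulr1n => <-.
      by apply: eq_bigr => i _; rewrite mxE expr2.
    rewrite exprMn rt2; field.
    by rewrite !gt_eqF.
  by rewrite sumEFin sumr_const card_ord -[_ *+ K]mulr_natl -mulrA.
- exact: cvg_cst.
- apply: cvg_EFin; first exact: nearW.
  rewrite [X in _ --> X](_ : 0 = 16 * (M + sigma0 ^+ 4) / sigma0 ^+ 4 * 0
    + K%:R * 4 * (0 * 0)); last by rewrite !mulr0 addr0.
  have nV : (n%:R^-1 : R) @[n --> \oo] --> 0.
    apply/gtr0_cvgV0; last exact: cvgr_idn.
    by near=> n; rewrite ltr0n; near: n; exact: nbhs_infty_gt.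
  have CV : (C n)^-1 @[n --> \oo] --> 0.
    by apply/gtr0_cvgV0 => //; exact: nearW.
  apply: cvgD; apply: cvgM; try exact: cvg_cst; first exact: nV.
  exact: cvgM.
Unshelve. all: by end_near.
Qed.
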